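(* Let $F(x)=\sum_{k=1}^{\infty}p_{x_k} I_{x_k}(x)$, $x\in\mathbb{R}$, be a discrete distribution function, where $x_k$, $k\in\mathbb{N}$, are distinct real numbers, $p_{x_k}\geqslant 0$ for all $k\in\mathbb{N}$, and $\sum_{k=1}^\infty p_{x_k}=1$. Let $X=\{x_k : p_{x_k}>0,\ k\in\mathbb{N}\}$, and let $f(t)=\sum_{k=1}^{\infty}p_{x_k}e^{itx_k}$, $t\in\mathbb{R}$, be the characteristic function of $F$. Assume that there exists $\mu>0$ such that $|f(t)|\geqslant\mu$ for all $t\in\mathbb{R}$. Then $f$ admits the representation $$f(t)=\exp\Bigl\{it\gamma+\sum_{u\in\langle X\rangle\setminus\{0\}}\lambda_u\,(e^{itu}-1)\Bigr\},\quad t\in\mathbb{R},$$ where $\gamma\in\langle X\rangle$, $\lambda_u\in\mathbb{R}$ for all $u\in\langle X\rangle\setminus\{0\}$, and $\sum_{u\in\langle X\rangle\setminus\{0\}}|\lambda_u|<\infty$.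
   Context: $\mathbb{N}$ is the set of positive integers. For $c\in\mathbb{R}$, $I_c(x)=1$ if $x\geqslant c$ and $I_c(x)=0$ if $x<c$. For a set $Y\subset\mathbb{R}$, $\langle Y\rangle=\bigl\{\sum_{k=1}^m c_k y_k : c_k\in\mathbb{Z},\ y_k\in Y,\ m\in\mathbb{N}\bigr\}$ is the set of all finite $\mathbb{Z}$-linear combinations of elements of $Y$ (the $\mathbb{Z}$-module generated by $Y$). Sums over the empty set equal zero. *)

(* Defs.v *)
From HB Require Import structures.
From mathcomp Require Import all_boot all_order all_algebra.
From mathcomp Require Import all_classical all_reals all_analysis.
From mathcomp Require Import complex.
(* Not imported: its [summable] would shadow the one of [esum], and [sum] is
   used qualified. [summability.sum g], for a family g indexed by a type I, is
   the unordered sum, i.e. the limit of the sums of g over the finite subsets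
   of I, directed by inclusion. *)
From mathcomp Require summability.

Set Implicit Arguments.
Unset Strict Implicit.
Unset Printing Implicit Defensive.

Import Order.TTheory GRing.Theory Num.Theory.
Import numFieldNormedType.Exports.

Local Open Scope classical_set_scope.
Local Open Scope ring_scope.
Local Open Scope complex_scope.

(* The usual topology on R[i], given by the modulus; instances for numeric
   fields are not inferred on a concrete type such as R[i]. *)
HB.instance Definition _ (R : realType) := NormedModule.copy R[i] R[i]^o.

(* exp (a + i b) = e^a (cos b + i sin b) *)
Definition cexp (R : realType) (z : R[i]) : R[i] :=
  let: a +i* b := z in (expR a * cos b) +i* (expR a * sin b).

Definition unit_step (R : realType) (c x : R) : R := if c <= x then 1 else 0.

Definition zspan (R : realType) (Y : set R) : set R :=
  [set z | exists (m : nat) (c : 'I_m -> int) (y : 'I_m -> R),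
    [/\ (0 < m)%N, forall k, Y (y k) & z = \sum_(k < m) (c k)%:~R * y k]].

(* Main.v *)
Require Import Defs.
From HB Require Import structures.
From mathcomp Require Import all_boot all_order all_algebra.
From mathcomp Require Import all_classical all_reals all_analysis.
From mathcomp Require Import complex finmap ring lra zify.
From mathcomp Require summability.

(** The elements of [ell1 R V] are the absolutely summable families of real
    coefficients indexed by an abelian group [V]; with convolution they form a
    Banach algebra, and [ev phi t] sums [a v * exp (i t (phi v))].

    If [|ev phi t a| <= r] for all [t], then [nrm (a ^+ n) = O(r' ^+ n)] for every
    [r' > r]: for [a] of finite support, [a ^+ n] has polynomially many nonzero
    coefficients, each at most [r ^+ n] as a mean value of its transform. Applied
    to [1 - a * adj a / M ^+ 2], this makes every [a] with [|ev phi t a| >= mu > 0]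
    invertible; applied to the logarithmic series, it makes [1 + e] an exponential
    as soon as [|ev phi t e| <= r < 1].

    Write [f = P * (1 + e)] with [P] a truncation of [f] and [|ev phi t e| <= 1/2].
    The support of [P] lies in a free group [Z^d]. With [D_j] the derivation
    multiplying the coefficient at [m] by [m_j], the logarithmic derivatives
    [D_j P / P] have a common primitive [h] up to their constant terms [g_j],
    summable since nonzero integers are at least 1 in modulus. Then
    [Q := P * exp (- h)] satisfies [D_j Q = g_j Q], which forces [Q] to have a
    single nonzero coefficient: [P] is a monomial times [exp h]. *)

Set Implicit Arguments.
Unset Strict Implicit.
Unset Printing Implicit Defensive.

Import Order.TTheory GRing.Theory Num.Theory.
Import numFieldNormedType.Exports.

Local Open Scope classical_set_scope.
Local Open Scope ring_scope.
Local Open Scope complex_scope.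

(* The hypothesis bounds a supremum norm, whereas the conclusion asks for summable coefficients, and
   [nrm] may far exceed the supremum of the transform. Power series bridge the two, since their
   convergence depends only on [nrm (a ^+ n)] for large [n]. Integrating [f' / f] in [t] would fail:
   [f'] need not have summable coefficients, and the elements of the group generated by [X] may
   accumulate at 0, so that dividing coefficients by them destroys summability. A finite truncation
   cures both defects: it can be differentiated at will, and every nonzero point of [Z^d] has a
   coordinate by which it is safe to divide. The price is that one derivative becomes [d] partial
   ones, with a common primitive only because the mixed derivatives agree. The transform is known
   only along a line in the torus; means along that line still recover coefficients because [phi] is
   injective, which stands in for Kronecker's density theorem. All coefficients are real and all
   frequencies stay in the group, whence real [lambda] and [gamma] in the span; the leftover
   constant is fixed by [f 0 = 1]. *)
#[local] Existing Instance summability.totally_filter.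

(** * Unordered sums of real families *)

Section unordered_sums.
Variable R : realType.
Implicit Types T : choiceType.

(* [sm f]: the family [f] is absolutely summable; [us f] is its unordered sum. *)
Definition sm T (f : T -> R) := summable [set: T] (EFin \o f).
Definition us T (f : T -> R) : R := summability.sum (f : T -> R^o).

Lemma partial_sumE T (f : T -> R) (J : {fset T}) :
  summability.partial_sum f J = \sum_(i <- J) f i.
Proof. by rewrite /summability.partial_sum [RHS]big_seq_fsetE. Qed.

Lemma sum_le_esum T (f : T -> R) (J : {fset T}) : (forall i, 0 <= f i) ->
  ((\sum_(i <- J) f i)%:E <= \esum_(i in [set: T]) (f i)%:E)%E.
Proof.
move=> f0; apply: esum_ge; exists [set` J]; first by split=> //; exact: finite_fset.
by rewrite fsbig_finite//= set_fsetK sumEFin.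
Qed.

Lemma smP T (f : T -> R) :
  sm f <-> exists M, forall J : {fset T}, \sum_(i <- J) `|f i| <= M.
Proof.
split=> [sf|[M HM]].
  exists (fine (\esum_(x in [set: T]) `|(EFin \o f) x|%E)) => J.
  rewrite -lee_fin fineK; last by rewrite -summableE.
  by apply: (@sum_le_esum _ (fun i => `|f i|)).
apply: (@le_lt_trans _ _ M%:E); last exact: ltry.
apply: ge_ereal_sup => _ [X [finX _] <-].
rewrite fsbig_finite//= sumEFin lee_fin; exact: HM.
Qed.

(** For nonnegative terms the supremum of the finite sums is also their limit along inclusion. This
    identifies [us] with [esum], whose reindexing and exchange lemmas are then inherited. *)
Lemma cvg_us_nneg T (f : T -> R) : (forall i, 0 <= f i) -> sm f ->
  (summability.partial_sum f : {fset T} -> R^o) @ summability.totally -->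
  (fine (\esum_(i in [set: T]) (f i)%:E) : R^o).
Proof.
move=> f0 sf; set S := \esum_(i in _) _.
have Sfin : S \is a fin_num.
  move: sf; rewrite /sm summableE; congr (_ \is a fin_num).
  by apply: eq_esum => i _ /=; rewrite ger0_norm.
apply/cvgrPdist_lt => e e0.
have : (S - e%:E < S)%E by rewrite lteBlDr// lteDl// lte_fin.
move=> /ereal_sup_gt[_ [X [finX _] <-]].
rewrite fsbig_finite//= sumEFin -(fineK Sfin) -EFinB lte_fin => He.
exists (fset_set X) => //= J XJ.
rewrite partial_sumE.
have HJ : \sum_(i <- J) f i <= fine S.
  by rewrite -lee_fin fineK//; exact: sum_le_esum.
have HX : \sum_(i <- fset_set X) f i <= \sum_(i <- J) f i.
  rewrite [leRHS](big_fsetID _ (mem (fset_set X)))/=.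
  have -> : [fset x | x in J & x \in fset_set X]%fset = fset_set X.
    by apply/fsetP => x; rewrite !inE/= andb_idl// => /(fsubsetP XJ).
  by rewrite lerDl sumr_ge0.
by rewrite ger0_norm ?subr_ge0//; lra.
Qed.

Lemma sm_le T (f g : T -> R) : (forall i, `|f i| <= g i) -> sm g -> sm f.
Proof.
move=> fg /smP[M HM]; apply/smP; exists M => J; apply: le_trans (HM J).
by apply: ler_sum => i _; apply: le_trans (fg i) (ler_norm _).
Qed.

Lemma eq_sm T (f g : T -> R) : f =1 g -> sm f -> sm g.
Proof. by move=> /funext->. Qed.

Lemma sm_abs T (f : T -> R) : sm f -> sm (fun i => `|f i|).
Proof. by move=> /smP[M HM]; apply/smP; exists M => J; under eq_bigr do rewrite normr_id. Qed.

Lemma smD T (f g : T -> R) : sm f -> sm g -> sm (fun i => f i + g i).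
Proof.
move=> /smP[M HM] /smP[N HN]; apply/smP; exists (M + N) => J.
apply: le_trans (lerD (HM J) (HN J)); rewrite -big_split; apply: ler_sum => i _.
exact: ler_normD.
Qed.

Lemma smZ T (c : R) (f : T -> R) : sm f -> sm (fun i => c * f i).
Proof.
move=> /smP[M HM]; apply/smP; exists (`|c| * M) => J.
under eq_bigr do rewrite normrM; rewrite -mulr_sumr; exact: ler_wpM2l.
Qed.

Lemma smZr T (c : R) (f : T -> R) : sm f -> sm (fun i => f i * c).
Proof. by move=> /(smZ c); apply: eq_sm => i; rewrite mulrC. Qed.

Lemma smN T (f : T -> R) : sm f -> sm (fun i => - f i).
Proof. by move=> /(smZ (-1)); apply: eq_sm => i; rewrite mulN1r. Qed.

Lemma sm0 T : sm (fun _ : T => 0).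
Proof. by apply/smP; exists 0 => J; rewrite big1// => i _; rewrite normr0. Qed.

Lemma us_unique T (f : T -> R) (l : R) :
  (summability.partial_sum f : {fset T} -> R^o) @ summability.totally --> (l : R^o) ->
  us f = l.
Proof. by move=> H; apply: cvg_lim H; exact: norm_hausdorff. Qed.

Lemma us_cvg T (f : T -> R) : sm f ->
  (summability.partial_sum f : {fset T} -> R^o) @ summability.totally --> (us f : R^o).
Proof.
move=> sf; pose p i := Num.max (f i) 0; pose n i := Num.max (- f i) 0.
have p0 i : 0 <= p i by rewrite le_max lexx orbT.
have n0 i : 0 <= n i by rewrite le_max lexx orbT.
have sp : sm p.
  by apply: sm_le (sm_abs sf) => i; rewrite ger0_norm// ge_max ler_norm normr_ge0.
have sn : sm n.
  by apply: sm_le (sm_abs sf) => i; rewrite ger0_norm// ge_max -normrN ler_norm normr_ge0.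
have E : summability.partial_sum f =
    (fun J => summability.partial_sum p J - summability.partial_sum n J).
  apply/funext => J; rewrite !partial_sumE -sumrB; apply: eq_bigr => i _.
  rewrite /p /n; case: (leP 0 (f i)) => h.
    by rewrite (max_idPr _) ?subr0// oppr_le0.
  by rewrite (max_idPl _) ?sub0r ?opprK// oppr_ge0 ltW.
suff H : (summability.partial_sum f : {fset T} -> R^o) @ summability.totally -->
    (fine (\esum_(i in [set: T]) (p i)%:E) - fine (\esum_(i in [set: T]) (n i)%:E) : R^o).
  by rewrite (us_unique H).
rewrite E; exact: cvgB (cvg_us_nneg p0 sp) (cvg_us_nneg n0 sn).
Qed.

Lemma us_nneg T (f : T -> R) : (forall i, 0 <= f i) -> sm f ->
  \esum_(i in [set: T]) (f i)%:E = (us f)%:E.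
Proof.
move=> f0 sf; rewrite (us_unique (cvg_us_nneg f0 sf)) fineK//.
move: sf; rewrite /sm summableE; congr (_ \is a fin_num).
by apply: eq_esum => i _ /=; rewrite ger0_norm.
Qed.

Lemma eq_us T (f g : T -> R) : f =1 g -> us f = us g.
Proof. by move=> /funext->. Qed.

Lemma usD T (f g : T -> R) : sm f -> sm g -> us (fun i => f i + g i) = us f + us g.
Proof.
move=> sf sg; apply: us_unique.
rewrite (_ : summability.partial_sum _ =
    (fun J => summability.partial_sum f J + summability.partial_sum g J)).
  exact: cvgD (us_cvg sf) (us_cvg sg).
by apply/funext => J; rewrite !partial_sumE -big_split.
Qed.

Lemma usZ T c (f : T -> R) : sm f -> us (fun i => c * f i) = c * us f.
Proof.
move=> sf; apply: us_unique.
rewrite (_ : summability.partial_sum _ =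
    (fun J => c * summability.partial_sum f J)).
  exact: cvgMr (us_cvg sf).
by apply/funext => J; rewrite !partial_sumE mulr_sumr.
Qed.

Lemma usZr T c (f : T -> R) : sm f -> us (fun i => f i * c) = us f * c.
Proof. by move=> sf; rewrite mulrC -usZ//; apply: eq_us => i; rewrite mulrC. Qed.

Lemma usN T (f : T -> R) : sm f -> us (fun i => - f i) = - us f.
Proof. by move=> sf; rewrite -mulN1r -usZ//; apply: eq_us => i; rewrite mulN1r. Qed.

Lemma usB T (f g : T -> R) : sm f -> sm g -> us (fun i => f i - g i) = us f - us g.
Proof. by move=> sf sg; rewrite usD ?usN//; exact: smN. Qed.

Lemma us0 T : us (fun _ : T => 0) = 0.
Proof.
apply: us_unique; rewrite (_ : summability.partial_sum _ = (fun=> 0)).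
  exact: cvg_cst.
by apply/funext => J; rewrite partial_sumE big1.
Qed.

Lemma us_ge0 T (f : T -> R) : (forall i, 0 <= f i) -> 0 <= us f.
Proof.
move=> f0; have [sf|nsf] := pselect (cvg (summability.partial_sum (f : T -> R^o) @ summability.totally)).
  apply: (@limr_ge _ _ _ _ _ _ sf).
  by apply: nearW => J; rewrite partial_sumE sumr_ge0.
(* A divergent family gets the default value of [lim], which is 0. *)
by rewrite /us /summability.sum (dvgP nsf).
Qed.

Lemma le_us T (f g : T -> R) : sm f -> sm g -> (forall i, f i <= g i) -> us f <= us g.
Proof.
move=> sf sg fg; rewrite -subr_ge0 -usB//; apply: us_ge0 => i; by rewrite subr_ge0.
Qed.

Lemma us_abs T (f : T -> R) : sm f -> `|us f| <= us (fun i => `|f i|).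
Proof.
move=> sf; have sa := sm_abs sf.
rewrite ler_norml; apply/andP; split.
  by rewrite -usN//; apply: le_us => //; [exact: smN|move=> i; rewrite lerNl -normrN ler_norm].
by apply: le_us => // i; exact: ler_norm.
Qed.

Lemma us_fin T (f : T -> R) (J : {fset T}) : (forall i, i \notin J -> f i = 0) ->
  sm f /\ us f = \sum_(i <- J) f i.
Proof.
move=> f0; have sf : sm f.
  apply/smP; exists (\sum_(i <- J) `|f i|) => K.
  rewrite (big_fsetID _ (mem J))/= [X in _ + X]big1_fset ?addr0; last first.
    by move=> i; rewrite !inE => /andP[_ /f0->]; rewrite normr0.
  rewrite [leRHS](big_fsetID _ (mem K))/= (_ : [fset x | x in K & x \in J]%fset = [fset x | x in J & x \in K]%fset).
    by rewrite lerDl sumr_ge0.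
  by apply/fsetP => i; rewrite !inE andbC.
split=> //; apply: us_unique; apply/cvgrPdist_lt => e e0; exists J => //= K JK.
rewrite partial_sumE [X in _ - X](big_fsetID _ (mem J))/= [X in _ - (_ + X)]big1_fset ?addr0; last first.
  by move=> i; rewrite !inE => /andP[_ /f0->].
rewrite (_ : [fset x | x in K & x \in J]%fset = J) ?subrr ?normr0//.
by apply/fsetP => i; rewrite !inE/= andb_idl// => /(fsubsetP JK).
Qed.

Lemma sm1 T (k : T) (f : T -> R) : (forall i, i != k -> f i = 0) -> sm f.
Proof. by move=> f0; apply: (@us_fin _ _ [fset k]%fset _).1 => i; rewrite inE => /f0. Qed.

Lemma us1 T (k : T) (f : T -> R) : (forall i, i != k -> f i = 0) -> us f = f k.
Proof.
move=> f0; rewrite (@us_fin _ f [fset k]%fset _).2 ?big_seq_fset1// => i.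
by rewrite inE => /f0.
Qed.

Lemma sm_inj T1 T2 (e : T1 -> T2) (f : T2 -> R) : injective e -> sm f -> sm (f \o e).
Proof.
move=> ei /smP[M HM]; apply/smP; exists M => J.
apply: le_trans (HM (e @` J)%fset); rewrite big_imfset//=.
by move=> x y _ _ /ei.
Qed.

Lemma sum_le_us T (f : T -> R) (J : {fset T}) : (forall i, 0 <= f i) -> sm f ->
  \sum_(i <- J) f i <= us f.
Proof. by move=> f0 sf; rewrite -lee_fin -us_nneg//; exact: sum_le_esum. Qed.

Lemma le1_us T (f : T -> R) k : (forall i, 0 <= f i) -> sm f -> f k <= us f.
Proof. by move=> f0 sf; have := sum_le_us [fset k]%fset f0 sf; rewrite big_seq_fset1. Qed.

(** Rearrangements proved for nonnegative families through [esum] pass to signed families by this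
    splitting. *)
Lemma us_posneg T (f : T -> R) : sm f -> exists p n,
  [/\ (forall i, 0 <= p i), (forall i, 0 <= n i), sm p, sm n &
   forall i, f i = p i - n i].
Proof.
move=> sf; exists (fun i => Num.max (f i) 0), (fun i => Num.max (- f i) 0); split.
- by move=> i; rewrite le_max lexx orbT.
- by move=> i; rewrite le_max lexx orbT.
- apply: sm_le (sm_abs sf) => i; rewrite ger0_norm ?ge_max ?ler_norm ?normr_ge0//.
  by rewrite le_max lexx orbT.
- apply: sm_le (sm_abs sf) => i; rewrite ger0_norm ?ge_max -1?normrN ?ler_norm ?normr_ge0//.
  by rewrite le_max lexx orbT.
move=> i; case: (leP 0 (f i)) => h.
  by rewrite (max_idPr _) ?subr0// oppr_le0.
by rewrite (max_idPl _) ?sub0r ?opprK// oppr_ge0 ltW.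
Qed.

Lemma us_bij T1 T2 (e : T1 -> T2) (f : T2 -> R) : bijective e -> sm f ->
  us (fun i => f (e i)) = us f.
Proof.
move=> be; have H (g : T2 -> R) : (forall i, 0 <= g i) -> sm g ->
    us (fun i => g (e i)) = us g.
  move=> g0 sg; apply: EFin_inj; rewrite -!us_nneg//; last exact: sm_inj (bij_inj be) sg.
  symmetry; apply: (reindex_esum [set: T1] [set: T2] e (fun i => (g i)%:E)).
  by rewrite setTT_bijective.
move=> sf; have [p [n [p0 n0 sp sn fpn]]] := us_posneg sf.
rewrite (eq_us fpn) usB// -(H p)// -(H n)// -usB.
- by apply: eq_us => i; rewrite fpn.
- exact: (@sm_inj _ _ e p (bij_inj be) sp).
- exact: (@sm_inj _ _ e n (bij_inj be) sn).
Qed.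

Lemma esum_pair T1 T2 (f : T1 * T2 -> \bar R) : (forall x, 0 <= f x)%E ->
  (\esum_(x in [set: T1 * T2]) f x =
  \esum_(i in [set: T1]) \esum_(j in [set: T2]) f (i, j))%E.
Proof.
move=> f0; rewrite (@esum_esum _ _ _ [set: T1] (fun=> [set: T2]) (fun i j => f (i, j)))//.
rewrite (_ : [set: T1] `*`` (fun=> [set: T2]) = setT); last by apply/seteqP; split.
by apply: eq_esum => -[].
Qed.

(** Tonelli's criterion, with [sm_fst] and [sm_us_abs] as its converse. *)
Lemma sm_pair T1 T2 (f : T1 * T2 -> R) : (forall i, sm (fun j => f (i, j))) ->
  sm (fun i => us (fun j => `|f (i, j)|)) -> sm f.
Proof.
move=> s1 s2; rewrite /sm /summable esum_pair; last by move=> x; exact: abse_ge0.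
apply: le_lt_trans s2; apply: le_esum => i _ /=.
rewrite (us_nneg (f := fun j => `|f (i, j)|))//; last exact: sm_abs.
by rewrite lee_fin ler_norm.
Qed.

Lemma sm_fst T1 T2 (f : T1 * T2 -> R) i : sm f -> sm (fun j => f (i, j)).
Proof. by move=> sf; apply: (@sm_inj _ _ (pair i) f) => // x y []. Qed.

Lemma sm_us_abs T1 T2 (f : T1 * T2 -> R) : sm f -> sm (fun i => us (fun j => `|f (i, j)|)).
Proof.
move=> sf; have := sf; rewrite /sm /summable esum_pair; last by move=> x; exact: abse_ge0.
apply: le_lt_trans; apply: le_esum => i _ /=.
rewrite (us_nneg (f := fun j => `|f (i, j)|))//; last exact/sm_abs/sm_fst.
rewrite lee_fin ger0_norm//; apply: us_ge0 => j; exact: normr_ge0.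
Qed.

Lemma sm_us T1 T2 (f : T1 * T2 -> R) : sm f -> sm (fun i => us (fun j => f (i, j))).
Proof.
by move=> sf; apply: sm_le (sm_us_abs sf) => i; apply: us_abs; exact: sm_fst.
Qed.

Lemma us_pair T1 T2 (f : T1 * T2 -> R) : sm f ->
  us f = us (fun i => us (fun j => f (i, j))).
Proof.
have H (g : T1 * T2 -> R) : (forall i, 0 <= g i) -> sm g ->
    us g = us (fun i => us (fun j => g (i, j))).
  move=> g0 sg; apply: EFin_inj; rewrite -!us_nneg//; last 2 first.
  - by move=> i; exact: us_ge0.
  - exact: sm_us.
  rewrite esum_pair; last by move=> x; rewrite lee_fin.
  by apply: eq_esum => i _; rewrite us_nneg//; exact: sm_fst.
move=> sf; have [p [n [p0 n0 sp sn fpn]]] := us_posneg sf.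
rewrite (eq_us fpn) usB// H// (H n)// -usB; [|exact: sm_us..].
apply: eq_us => i; rewrite -usB; [|exact: sm_fst..].
by apply: eq_us => j; rewrite fpn.
Qed.

Lemma sm_swap T1 T2 (f : T1 * T2 -> R) : sm f -> sm (fun x : T2 * T1 => f (x.2, x.1)).
Proof. by apply: (@sm_inj _ _ (fun x : T2 * T1 => (x.2, x.1)) f) => -[a b] [c d] [-> ->]. Qed.

Lemma us_swap T1 T2 (f : T1 * T2 -> R) : sm f ->
  us (fun i => us (fun j => f (i, j))) = us (fun j => us (fun i => f (i, j))).
Proof.
move=> sf; rewrite -us_pair// -[LHS](@us_bij _ _ (fun x : T2 * T1 => (x.2, x.1)) f)//.
  by rewrite (us_pair (sm_swap sf)).
by exists (fun x => (x.2, x.1)) => -[].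
Qed.

Lemma sm_mul T1 T2 (a : T1 -> R) (b : T2 -> R) : sm a -> sm b ->
  sm (fun x => a x.1 * b x.2).
Proof.
move=> sa sb; apply: sm_pair => [i|]; first exact: (@smZ _ (a i) b sb).
apply: (@eq_sm _ (fun i => `|a i| * us (fun j => `|b j|))) => [i|].
  rewrite -(usZ _ (sm_abs sb)).
  by apply: eq_us => j; rewrite normrM.
exact: (smZr _ (sm_abs sa)).
Qed.

Lemma fset_nat_bound (J : {fset nat}) : exists N, forall k, k \in J -> (k < N)%N.
Proof.
suff [N HN] : exists N, forall k, k \in (J : seq nat) -> (k < N)%N by exists N.
elim: (J : seq nat) => [|x s [N HN]]; first by exists 0%N.
exists (maxn x.+1 N) => k; rewrite inE leq_max => /orP[/eqP->|/HN->]; rewrite ?leqnn ?orbT//.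
Qed.

(** Every finite set of indices lies in an initial segment, so convergence along finite sets
    restricts to the usual partial sums. *)
Lemma us_nat (f : nat -> R) : sm f -> series f @ \oo --> us f.
Proof.
move=> sf; apply/cvgrPdist_lt => e e0.
have /cvgrPdist_lt /(_ e e0) [J _ HJ] := us_cvg sf.
have [N HN] := fset_nat_bound J.
exists N => //= m Hm.
have := HJ [fset x in iota 0 m]%fset.
rewrite partial_sumE (perm_big (iota 0 m)); last first.
  by apply: uniq_perm; rewrite ?fset_uniq ?iota_uniq// => k; rewrite !inE.
move=> H1.
rewrite /series /= /index_iota subn0; apply: H1.
apply/fsubsetP => k kJ; rewrite !inE mem_iota add0n /=.
by apply: leq_trans Hm; exact: HN.
Qed.

Lemma sm_nat (f : nat -> R) : cvg (series (fun n => `|f n|) @ \oo) -> sm f.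
Proof.
move=> cf; apply/smP; exists (lim (series (fun n => `|f n|) @ \oo)) => J.
have [N HN] := fset_nat_bound J.
apply: (@le_trans _ _ (series (fun n => `|f n|) N)).
  rewrite -lee_fin /series /= -!sumEFin.
  by apply: (@lee_sum_fset_nat _ (fun i => (`|f i|)%:E) J N predT) => // k /= /HN.
by apply: (nondecreasing_cvgn_le _ cf); apply: nondecreasing_series.
Qed.

End unordered_sums.

(** * The group algebra of summable families *)

Section ell1.
Variables (R : realType) (V : zmodType).

Record ell1 := Ell1 { coef :> V -> R ; coef_sm : sm coef }.

HB.instance Definition _ := gen_eqMixin ell1.
HB.instance Definition _ := gen_choiceMixin ell1.

Lemma ell1P (a b : ell1) : a =1 b -> a = b.
Proof.
case: a b => [a sa] [b sb] /= /funext ab; subst b; congr Ell1; exact: Prop_irrelevance.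
Qed.

(** Bounded functions serve as test functions: by [ell1_ext], pairing with all of them determines an
    element, which spares most computations with convolution coefficients. *)
Definition bd (chi : V -> R) := exists M, forall v, `|chi v| <= M.

Lemma bd1 (v : V) : bd (fun u => (u == v)%:R).
Proof. by exists 1 => u; case: eqP; rewrite ?normr1 ?normr0. Qed.

Lemma sm_bd (I : choiceType) (c : I -> R) (chi : I -> R) M : sm c -> (forall i, `|chi i| <= M) ->
  sm (fun i => c i * chi i).
Proof.
move=> sc chiM; apply: (@sm_le _ _ _ (fun i => `|c i| * M)).
  by move=> i; rewrite normrM ler_wpM2l.
exact/smZr/sm_abs.
Qed.

Definition nrm (a : ell1) := us (fun v => `|a v|).

Lemma nrm_ge0 a : 0 <= nrm a. Proof. exact: us_ge0. Qed.

Lemma coef_le_nrm (a : ell1) v : `|a v| <= nrm a.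
Proof. by apply: (le1_us (f := fun v => `|a v|)) => //; apply/sm_abs/coef_sm. Qed.

Section fam.
Variables (I : choiceType) (c : I -> R) (w : I -> V) (sc : sm c).

Let sm_fam2 (chi : V -> R) : bd chi -> sm (fun x : I * V => (w x.1 == x.2)%:R * c x.1 * chi x.2).
Proof.
move=> [M HM]; apply: sm_pair => [i|].
  apply: (@sm1 _ _ (w i)) => v /negPf; rewrite eq_sym /= => ->.
  by rewrite !mul0r.
have M0 : 0 <= M by apply: le_trans (HM 0).
apply: (@sm_le _ _ _ (fun i => `|c i| * M)); last exact/smZr/sm_abs.
move=> i; rewrite (@us1 _ _ (w i)) /= => [|v /negPf]; last first.
  by rewrite eq_sym => ->; rewrite !mul0r normr0.
by rewrite eqxx mul1r normr_id normrM ler_wpM2l.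
Qed.

Let fam_coef v := us (fun i => (w i == v)%:R * c i).

Let bdT : bd (fun=> 1). Proof. by exists 1 => v; rewrite normr1. Qed.

Let sm_fam_coef : sm fam_coef.
Proof.
apply: eq_sm (sm_us (sm_swap (sm_fam2 bdT))) => v.
by apply: eq_us => i; rewrite /= mulr1.
Qed.

(** The image of the family [c] under [w], obtained by summing over the fibres of [w]. Convolution
    is the case where [w] is addition on pairs, and [push] the case of a map between groups. *)
Definition fam := Ell1 sm_fam_coef.

Lemma us_fam chi : bd chi -> us (fun v => fam v * chi v) = us (fun i => c i * chi (w i)).
Proof.
move=> bchi; transitivity (us (fun v => us (fun i => (w i == v)%:R * c i * chi v))).
  apply: eq_us => v /=; rewrite /fam_coef -usZr//.
  have /sm_le : forall i, `|(w i == v)%:R * c i| <= `|c i|; last by apply; exact: sm_abs.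
  by move=> i; case: eqP; rewrite ?mul1r ?mul0r ?normr0.
rewrite -(us_swap (sm_fam2 bchi)); apply: eq_us => i /=.
rewrite (@us1 _ _ (w i)) ?eqxx ?mul1r// => v /negPf; rewrite eq_sym => ->.
by rewrite !mul0r.
Qed.

Lemma fam_unique (b : ell1) :
  (forall chi, bd chi -> us (fun v => b v * chi v) = us (fun i => c i * chi (w i))) ->
  b = fam.
Proof.
move=> H; apply: ell1P => v.
have := H _ (bd1 v); rewrite -(us_fam (bd1 v)).
rewrite (@us1 _ _ v) => [|u /negPf->]; last by rewrite mulr0.
by rewrite [RHS](@us1 _ _ v) => [|u /negPf->]; rewrite ?eqxx ?mulr1// mulr0.
Qed.

Lemma nrm_fam : nrm fam <= us (fun i => `|c i|).
Proof.
have -> : us (fun i => `|c i|) = us (fun v => us (fun i => `|(w i == v)%:R * c i * 1|)).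
  have := sm_abs (sm_fam2 bdT) => /us_swap /= <-; apply: eq_us => i.
  rewrite (@us1 _ _ (w i)) ?eqxx ?mul1r ?mulr1// => v /negPf; rewrite eq_sym => ->.
  by rewrite !mul0r normr0.
apply: le_us; first exact/sm_abs/coef_sm.
  exact: sm_us_abs (sm_swap (sm_fam2 bdT)).
move=> v; rewrite /= /fam_coef (_ : us _ = us (fun i => (w i == v)%:R * c i * 1)).
  apply: us_abs; exact: sm_fst (sm_swap (sm_fam2 bdT)).
by apply: eq_us => i; rewrite mulr1.
Qed.

End fam.

Lemma ell1_ext (a b : ell1) :
  (forall chi, bd chi -> us (fun v => a v * chi v) = us (fun v => b v * chi v)) -> a = b.
Proof.
move=> H; rewrite [LHS](fam_unique (coef_sm b) (w := id) H).
by apply/esym/fam_unique.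
Qed.

Lemma sm_coef_bd (a : ell1) chi : bd chi -> sm (fun v => a v * chi v).
Proof. by move=> [M HM]; apply: sm_bd HM; exact: coef_sm. Qed.

Lemma us_coef_bd (a : ell1) chi M : (forall v, `|chi v| <= M) ->
  `|us (fun v => a v * chi v)| <= nrm a * M.
Proof.
move=> HM; have sa : sm (fun v => a v * chi v) by apply: sm_coef_bd; exists M.
apply: le_trans (us_abs sa) _.
rewrite /nrm -usZr; last exact/sm_abs/coef_sm.
apply: le_us; [exact: sm_abs|exact/smZr/sm_abs/coef_sm|move=> v].
by rewrite normrM ler_wpM2l.
Qed.

Definition ell1_zero := Ell1 (@sm0 R V).
Definition ell1_opp (a : ell1) := Ell1 (smN (coef_sm a)).
Definition ell1_add (a b : ell1) := Ell1 (smD (coef_sm a) (coef_sm b)).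

Fact ell1_addA : associative ell1_add.
Proof. by move=> a b c; apply: ell1P => v /=; rewrite addrA. Qed.
Fact ell1_addC : commutative ell1_add.
Proof. by move=> a b; apply: ell1P => v /=; rewrite addrC. Qed.
Fact ell1_add0 : left_id ell1_zero ell1_add.
Proof. by move=> a; apply: ell1P => v /=; rewrite add0r. Qed.
Fact ell1_addN : left_inverse ell1_zero ell1_opp ell1_add.
Proof. by move=> a; apply: ell1P => v /=; rewrite addNr. Qed.

HB.instance Definition _ := GRing.isZmodule.Build ell1
  ell1_addA ell1_addC ell1_add0 ell1_addN.

Lemma coefD (a b : ell1) v : (a + b) v = a v + b v. Proof. by []. Qed.
Lemma coefN (a : ell1) v : (- a) v = - a v. Proof. by []. Qed.
Lemma coef0 v : (0 : ell1) v = 0. Proof. by []. Qed.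

Fact delta_subproof (v : V) : sm (fun u => (u == v)%:R : R).
Proof. by apply: (@sm1 _ _ v) => u /negPf->. Qed.
Definition delta v := Ell1 (delta_subproof v).

Lemma us_delta v chi : us (fun u => delta v u * chi u) = chi v.
Proof. by rewrite (@us1 _ _ v) /= ?eqxx ?mul1r// => u /negPf->; rewrite mul0r. Qed.

Definition ell1_mul (a b : ell1) :=
  fam (fun x => x.1 + x.2) (sm_mul (coef_sm a) (coef_sm b)).

(** Through this iterated pairing, associativity, the unit law and distributivity become identities
    between inner test functions. *)
Lemma us_mul (a b : ell1) chi : bd chi ->
  us (fun v => ell1_mul a b v * chi v) =
  us (fun u => a u * us (fun v => b v * chi (u + v))).
Proof.
move=> bchi; rewrite us_fam// us_pair /=; last first.
  move: bchi => [M HM].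
  by apply: (@sm_bd _ (fun x => a x.1 * b x.2)) => //; exact: sm_mul (coef_sm a) (coef_sm b).
apply: eq_us => u; rewrite -usZ; last first.
  by apply: (@sm_coef_bd b (fun v => chi (u + v))); case: bchi => M HM; exists M.
by apply: eq_us => v; rewrite mulrA.
Qed.

Lemma bd_inner (b : ell1) chi : bd chi -> bd (fun u => us (fun v => b v * chi (u + v))).
Proof. by move=> [M HM]; exists (nrm b * M) => u; apply: us_coef_bd. Qed.

Lemma bd_shift chi u : bd chi -> bd (fun v => chi (u + v)).
Proof. by move=> [M HM]; exists M. Qed.

Fact ell1_mulC : commutative ell1_mul.
Proof.
move=> a b; apply: fam_unique => chi bchi; rewrite us_fam//.
rewrite -[RHS](@us_bij _ _ _ (fun x : V * V => (x.2, x.1))); last 2 first.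
- by exists (fun x => (x.2, x.1)) => -[].
- move: bchi => [M HM]; apply: (@sm_bd _ (fun x => b x.1 * a x.2)) => //.
  exact: sm_mul (coef_sm b) (coef_sm a).
by apply: eq_us => -[u v] /=; rewrite [b v * _]mulrC [v + u]addrC.
Qed.

Fact ell1_mulA : associative ell1_mul.
Proof.
move=> a b c; apply: ell1_ext => chi bchi.
rewrite us_mul// us_mul// us_mul; last exact: bd_inner.
apply: eq_us => u; congr (_ * _); rewrite us_mul; last exact: bd_shift.
by apply: eq_us => v; congr (_ * _); apply: eq_us => w; rewrite addrA.
Qed.

Fact ell1_mul1 : left_id (delta 0) ell1_mul.
Proof.
move=> a; apply: ell1_ext => chi bchi; rewrite us_mul// us_delta.
by apply: eq_us => v; rewrite add0r.
Qed.

Fact ell1_mulD : left_distributive ell1_mul ell1_add.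
Proof.
move=> a b c; apply: ell1_ext => chi bchi; rewrite us_mul//.
have Ha := us_mul a c bchi; have Hb := us_mul b c bchi.
have Hd : forall (x y : ell1) (g : V -> R), bd g ->
    us (fun v => ell1_add x y v * g v) = us (fun v => x v * g v) + us (fun v => y v * g v).
  move=> x y g bg; rewrite -usD; [|exact: sm_coef_bd..].
  by apply: eq_us => v; rewrite -mulrDl.
by rewrite !Hd// ?Ha ?Hb//; exact: bd_inner.
Qed.

Fact ell1_oner_neq0 : delta 0 != 0 :> ell1.
Proof. by apply/eqP => /(congr1 (fun a : ell1 => a 0))/=/eqP; rewrite eqxx oner_eq0. Qed.

HB.instance Definition _ := GRing.Zmodule_isComNzRing.Build ell1
  ell1_mulA ell1_mulC ell1_mul1 ell1_mulD ell1_oner_neq0.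

Lemma us_ind (a : V -> R) v : us (fun w => a w * (w == v)%:R) = a v.
Proof. by rewrite (@us1 _ _ v) ?eqxx ?mulr1// => w /negPf->; rewrite mulr0. Qed.

Lemma coefM_delta u (a : ell1) v : (delta u * a) v = a (v - u).
Proof.
rewrite -[LHS]us_ind -[RHS]us_ind (us_mul (delta u) a (bd1 v)) us_delta.
apply: eq_us => w; congr (_ * _%:R); congr nat_of_bool.
by apply/eqP/eqP => [<-|->]; rewrite addrC ?addKr ?addrK ?subrK.
Qed.

Fact cst_subproof (c : R) : sm (fun u : V => (u == 0)%:R * c).
Proof. by apply: (@sm1 _ _ 0) => u /negPf->; rewrite mul0r. Qed.
(** Scalars are embedded as multiples of the unit by a ring morphism, so that scalar multiples are
    ordinary products, within reach of [ring]. *)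
Definition cst c := Ell1 (cst_subproof c).

Lemma us_cst c chi : us (fun u => cst c u * chi u) = c * chi 0.
Proof. by rewrite (@us1 _ _ 0) /= ?eqxx ?mul1r// => u /negPf->; rewrite !mul0r. Qed.

Lemma coefZ c (a : ell1) v : (cst c * a) v = c * a v.
Proof.
rewrite -[LHS]us_ind (us_mul (cst c) a (bd1 v)) us_cst; congr (_ * _).
by under eq_us do rewrite add0r; rewrite us_ind.
Qed.

Fact cst_additive : zmod_morphism cst.
Proof. by move=> c d; apply: ell1P => v /=; rewrite mulrBr. Qed.
Fact cst_multiplicative : monoid_morphism cst.
Proof.
split; first by apply: ell1P => v /=; rewrite mulr1.
by move=> c d; apply: ell1P => v; rewrite coefZ /= mulrCA.
Qed.
HB.instance Definition _ := GRing.isZmodMorphism.Build R ell1 cst cst_additive.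
HB.instance Definition _ := GRing.isMonoidMorphism.Build R ell1 cst cst_multiplicative.

Lemma nrmD a b : nrm (a + b) <= nrm a + nrm b.
Proof.
rewrite /nrm -usD; [|exact/sm_abs/coef_sm..].
apply: le_us => [||v]; [exact/sm_abs/coef_sm| |exact: ler_normD].
by apply: smD; exact/sm_abs/coef_sm.
Qed.

Lemma nrmM a b : nrm (a * b) <= nrm a * nrm b.
Proof.
apply: le_trans (nrm_fam _ _) _; rewrite us_pair /=; last first.
  exact/sm_abs/sm_mul/coef_sm/coef_sm.
rewrite /nrm -usZr; last exact/sm_abs/coef_sm.
rewrite le_eqVlt; apply/orP; left; apply/eqP/eq_us => u.
rewrite -usZ; last exact/sm_abs/coef_sm.
by apply: eq_us => v; rewrite normrM.
Qed.

Lemma nrmN a : nrm (- a) = nrm a.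
Proof. by apply: eq_us => v; rewrite /= normrN. Qed.

Lemma nrm_delta v : nrm (delta v) = 1.
Proof. by rewrite /nrm (@us1 _ _ v) /= ?eqxx ?normr1// => u /negPf->; rewrite normr0. Qed.

Lemma nrmZ c a : nrm (cst c * a) = `|c| * nrm a.
Proof.
rewrite /nrm -usZ; last exact/sm_abs/coef_sm.
by apply: eq_us => v; rewrite coefZ normrM.
Qed.

Lemma nrm0 : nrm 0 = 0.
Proof. by rewrite /nrm -[RHS](@us0 R V); apply: eq_us => v; rewrite coef0 normr0. Qed.

Lemma nrm1 : nrm 1 = 1. Proof. exact: nrm_delta. Qed.

Lemma nrmX a n : nrm (a ^+ n) <= nrm a ^+ n.
Proof.
elim: n => [|n IH]; first by rewrite !expr0 nrm1.
by rewrite !exprS; apply: le_trans (nrmM _ _) _; rewrite ler_wpM2l// nrm_ge0.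
Qed.

Lemma nrm_sum (I : Type) (s : seq I) (P : pred I) (F : I -> ell1) :
  nrm (\sum_(i <- s | P i) F i) <= \sum_(i <- s | P i) nrm (F i).
Proof.
elim/big_ind2 : _ => //; first by rewrite nrm0.
by move=> x1 x2 y1 y2 H1 H2; apply: le_trans (nrmD _ _) _; exact: lerD.
Qed.

Lemma coef_sum (I : Type) (s : seq I) (P : pred I) (F : I -> ell1) v :
  (\sum_(i <- s | P i) F i) v = \sum_(i <- s | P i) F i v.
Proof. by apply: (big_morph (fun a : ell1 => a v)). Qed.

Section asum.
Variable (I : choiceType).
Implicit Type F : I -> ell1.

Lemma sm_asum2 F : sm (fun i => nrm (F i)) -> sm (fun x : I * V => F x.1 x.2).
Proof. exact: (@sm_pair _ _ _ (fun x => F x.1 x.2) (fun i => coef_sm (F i))). Qed.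

Lemma sm_asum_coef F : sm (fun i => nrm (F i)) -> sm (fun v => us (fun i => F i v)).
Proof. by move=> sF; exact: sm_us (sm_swap (sm_asum2 sF)). Qed.

(** The junk value 0 for non-summable norms keeps the summability proof out of the term, so that the
    family can be rewritten under [asum]. *)
Definition asum F : ell1 :=
  if pselect (sm (fun i => nrm (F i))) is left sF then Ell1 (sm_asum_coef sF) else 0.

Lemma coef_asum F v : sm (fun i => nrm (F i)) -> asum F v = us (fun i => F i v).
Proof. by rewrite /asum; case: pselect. Qed.

Lemma sm_coef_i F v : sm (fun i => nrm (F i)) -> sm (fun i => F i v).
Proof. by apply: sm_le => i; exact: coef_le_nrm. Qed.

Lemma us_asum F chi : bd chi -> sm (fun i => nrm (F i)) ->
  us (fun v => asum F v * chi v) = us (fun i => us (fun v => F i v * chi v)).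
Proof.
move=> [M HM] sF.
rewrite (@us_swap _ _ _ (fun x => F x.1 x.2 * chi x.2)) /=; last first.
  by apply: (@sm_bd _ (fun x => F x.1 x.2)) => //; exact: sm_asum2.
by apply: eq_us => v; rewrite coef_asum// usZr//; exact: sm_coef_i.
Qed.

Lemma sm_nrmM F a : sm (fun i => nrm (F i)) -> sm (fun i => nrm (a * F i)).
Proof.
move=> sF; apply: (@sm_le _ _ _ (fun i => nrm a * nrm (F i))); last exact: smZ.
by move=> i; rewrite ger0_norm ?nrm_ge0// nrmM.
Qed.

Lemma mul_asum F a : sm (fun i => nrm (F i)) -> a * asum F = asum (fun i => a * F i).
Proof.
move=> sF; apply: ell1_ext => chi bchi.
rewrite us_asum//; last exact: sm_nrmM.
rewrite mulrC us_mul// us_asum//; last exact: bd_inner.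
by apply: eq_us => i; rewrite mulrC us_mul.
Qed.

End asum.

End ell1.

(** * The complex exponential series *)

Section exp_partial_sums.
Variable K : numFieldType.

Definition exp_psum N (z : K) := \sum_(n < N) z ^+ n / n`!%:R.
(** The formal variable records degrees and evaluation at 1 forgets them. Below degree [N] the
    product of two truncations agrees with the series of the sum. *)
Let exp_poly N (z : K) := \poly_(n < N) (z ^+ n / n`!%:R).

Let fact_neq0 n : n`!%:R != 0 :> K.
Proof. by rewrite pnatr_eq0 -lt0n fact_gt0. Qed.

Let coef_exp_polyM N x y n : (n < N)%N ->
  (exp_poly N x * exp_poly N y)`_n = (x + y) ^+ n / n`!%:R.
Proof.
move=> nN; rewrite coefM addrC exprDn mulr_suml; apply: eq_bigr => -[j /= jn] _.
rewrite !coef_poly (leq_ltn_trans (leq_subr _ _) nN) (leq_ltn_trans _ nN)//.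
rewrite -(bin_fact (_ : (j <= n)%N))// -mulr_natl !natrM.
have : 'C(n, j)%:R != 0 :> K by rewrite pnatr_eq0 -lt0n bin_gt0.
move: (fact_neq0 j) (fact_neq0 (n - j)) => h1 h2 h3.
by field; rewrite h1 h2 h3.
Qed.

Let exp_poly1 N x : (exp_poly N x).[1] = exp_psum N x.
Proof. by rewrite horner_poly; apply: eq_bigr => i _; rewrite expr1n mulr1. Qed.

Let exp_psum_diff N x y : exp_psum N x * exp_psum N y - exp_psum N (x + y) =
  \sum_(i < N) (exp_poly N x * exp_poly N y)`_(N + i).
Proof.
rewrite -!exp_poly1 -hornerM.
rewrite (@horner_coef_wide _ (N + N)); last first.
  apply: leq_trans (size_polyMleq _ _) _; apply: leq_trans (leq_pred _) _.
  by apply: leq_add; exact: size_poly.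
rewrite big_split_ord /= exp_poly1.
rewrite [X in X + _ - _](_ : _ = exp_psum N (x + y)); last first.
  by apply: eq_bigr => i _; rewrite coef_exp_polyM// expr1n mulr1.
by rewrite [X in X - _]addrC addrK; apply: eq_bigr => i _; rewrite expr1n mulr1.
Qed.

(** The defect of multiplicativity collects the terms of total degree at least [N]. Replacing them
    by their moduli gives the same defect at [|x|] and [|y|], so the complex case is controlled by
    the real exponential. *)
Lemma exp_psum_bound N x y :
  `|exp_psum N x * exp_psum N y - exp_psum N (x + y)| <=
  exp_psum N `|x| * exp_psum N `|y| - exp_psum N (`|x| + `|y|).
Proof.
rewrite !exp_psum_diff; apply: le_trans (ler_norm_sum _ _ _) _.
apply: ler_sum => i _; rewrite !coefM; apply: le_trans (ler_norm_sum _ _ _) _.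
apply: ler_sum => j _; rewrite !coef_poly normrM.
have H n (z : K) : `|z ^+ n / n`!%:R| = `|z| ^+ n / n`!%:R.
  by rewrite normrM normrX normfV normr_nat.
by apply: ler_pM => //; case: ifP => _; rewrite ?normr0 ?H// divr_ge0 ?exprn_ge0 ?ler0n.
Qed.

End exp_partial_sums.

Section cexp_series.
Variable R : realType.
Local Notation K := R[i].
Local Notation Re := (@complex.Re R).
Local Notation Im := (@complex.Im R).
Local Notation normc := (@ComplexField.Normc.normc R).

Lemma normcE (z : K) : `|z| = (normc z)%:C.
Proof. by case: z => a b; rewrite normc_def. Qed.

Lemma normc_ge0 (z : K) : 0 <= normc z.
Proof. by case: z => a b; exact: sqrtr_ge0. Qed.

Lemma Re_le_normc (z : K) : `|Re z| <= normc z.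
Proof. by case: z => a b /=; rewrite -sqrtr_sqr ler_wsqrtr// lerDl sqr_ge0. Qed.

Lemma Im_le_normc (z : K) : `|Im z| <= normc z.
Proof. by case: z => a b /=; rewrite -sqrtr_sqr ler_wsqrtr// lerDr sqr_ge0. Qed.

Lemma normc_le (z : K) : normc z <= `|Re z| + `|Im z|.
Proof.
case: z => a b /=; rewrite -[leRHS]ger0_norm ?addr_ge0// -sqrtr_sqr ler_wsqrtr//.
rewrite sqrrD !real_normK ?num_real// lerD2r lerDl mulrn_wge0// mulr_ge0//.
Qed.

Lemma normcR (x : R) : normc x%:C = `|x|.
Proof. by rewrite /= expr0n addr0 sqrtr_sqr. Qed.

Lemma cexpD (z w : K) : cexp (z + w) = cexp z * cexp w.
Proof.
case: z w => a b [c d]; rewrite /cexp /= expRD cosD sinD.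
by apply/eqP; rewrite eq_complex /=; apply/andP; split; apply/eqP; ring.
Qed.

Lemma cexp0 : cexp (0 : K) = 1.
Proof. by rewrite /cexp /= expR0 cos0 sin0 mulr1 mulr0. Qed.

Let exp_psumR N (r : R) : exp_psum N r%:C = (series (exp_coeff r) N)%:C.
Proof.
rewrite /series /= big_mkord rmorph_sum; apply: eq_bigr => i _.
by rewrite /exp_coeff /= rmorphM rmorphXn fmorphV rmorph_nat.
Qed.

Let exp_psumI N (b : R) :
  exp_psum N (0 +i* b) = (series (cos_coeff b) N) +i* (series (sin_coeff b) N).
Proof.
rewrite /series /= !big_mkord /exp_psum; elim: N => [|N IH]; first by rewrite !big_ord0.
rewrite !big_ord_recr /= IH /cos_coeff /sin_coeff /=.
have -> : (0 +i* b) ^+ N / N`!%:R =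
  ((~~ odd N)%:R * (-1) ^+ N./2 * b ^+ N / N`!%:R) +i*
  ((odd N)%:R * (-1) ^+ N.-1./2 * b ^+ N / N`!%:R) :> K; last by [].
(* Powers of [i b] written with parity indicators, in the shape of [cos_coeff] and [sin_coeff]. *)
have -> : (0 +i* b) ^+ N = ((~~ odd N)%:R * (-1) ^+ N./2 * b ^+ N) +i*
    ((odd N)%:R * (-1) ^+ N.-1./2 * b ^+ N) :> K.
  elim: (N) => [|n IHn]; first by rewrite !expr0 /= ?mulr0n ?mulr1n ?mul0r !mulr1.
  rewrite exprSr IHn.
  have -> : (odd n.+1)%:R * (-1) ^+ n.+1.-1./2 = (~~ odd n)%:R * (-1) ^+ n./2 :> R by [].
  have -> : (~~ odd n.+1)%:R * (-1) ^+ n.+1./2 = - ((odd n)%:R * (-1) ^+ n.-1./2) :> R.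
    case: n {IHn} => [|n] /=; first by rewrite !mulr0n !mul0r oppr0.
    by rewrite negbK; case: (odd n); rewrite /= ?mulr0n ?mulr1n ?mul0r ?oppr0// !mul1r exprS mulN1r.
  by apply/eqP; rewrite eq_complex /= exprSr; apply/andP; split; apply/eqP; ring.
rewrite -(rmorph_nat (real_complex R)) -fmorphV.
by apply/eqP; rewrite eq_complex /=; apply/andP; split; apply/eqP; ring.
Qed.

(** The majorant from [exp_psum_bound] at [a] and [i b]; it tends to 0 by the functional equation of
    [expR]. *)
Let gap (a b : R) N : R := series (exp_coeff `|a|) N * series (exp_coeff `|b|) N -
  series (exp_coeff (`|a| + `|b|)) N.

Let gap_cvg a b : gap a b @ \oo --> (0 : R).
Proof.
rewrite (_ : 0 = expR `|a| * expR `|b| - expR (`|a| + `|b|)); last by rewrite expRD subrr.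
by apply: cvgB; [apply: cvgM|]; exact: is_cvg_series_exp_coeff.
Qed.

Let gap_bound a b N : normc ((series (exp_coeff a) N)%:C *
    ((series (cos_coeff b) N) +i* (series (sin_coeff b) N)) - exp_psum N (a +i* b)) <= gap a b N.
Proof.
rewrite -lecR -normcE -exp_psumI -exp_psumR.
have -> : a +i* b = a%:C + 0 +i* b by apply/eqP; rewrite eq_complex /= addr0 add0r !eqxx.
apply: le_trans (exp_psum_bound _ _ _) _.
rewrite !normcE.
rewrite normcR.
have -> : normc (0 +i* b) = `|b| by rewrite /= expr0n add0r sqrtr_sqr.
by rewrite -rmorphD !exp_psumR -rmorphM -rmorphB.
Qed.

Lemma cvg_exp_psum_Re (z : K) : (fun N => Re (exp_psum N z)) @ \oo --> Re (cexp z).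
Proof.
case: z => a b /=.
rewrite (_ : (fun N => _) = (fun N => series (exp_coeff a) N * series (cos_coeff b) N -
   (series (exp_coeff a) N * series (cos_coeff b) N - Re (exp_psum N (a +i* b))))); last first.
  by apply/funext => N; rewrite opprB addrC subrK.
rewrite -[X in _ --> X]subr0; apply: cvgB.
  apply: cvgM; first exact: is_cvg_series_exp_coeff.
  by rewrite unlock; exact: is_cvg_series_cos_coeff.
apply/norm_cvg0P; apply: (@squeeze_cvgr _ _ _ _ (fun=> 0) (gap a b)); last 2 first.
- exact: cvg_cst.
- exact: gap_cvg.
apply: nearW => N; rewrite normr_ge0 /=; apply: le_trans (gap_bound a b N).
apply: le_trans (Re_le_normc _); case: (exp_psum _ _) => c d /=.
by rewrite mul0r subr0.
Qed.

Lemma cvg_exp_psum_Im (z : K) : (fun N => Im (exp_psum N z)) @ \oo --> Im (cexp z).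
Proof.
case: z => a b /=.
rewrite (_ : (fun N => _) = (fun N => series (exp_coeff a) N * series (sin_coeff b) N -
   (series (exp_coeff a) N * series (sin_coeff b) N - Im (exp_psum N (a +i* b))))); last first.
  by apply/funext => N; rewrite opprB addrC subrK.
rewrite -[X in _ --> X]subr0; apply: cvgB.
  apply: cvgM; first exact: is_cvg_series_exp_coeff.
  by rewrite unlock; exact: is_cvg_series_sin_coeff.
apply/norm_cvg0P; apply: (@squeeze_cvgr _ _ _ _ (fun=> 0) (gap a b)); last 2 first.
- exact: cvg_cst.
- exact: gap_cvg.
apply: nearW => N; rewrite normr_ge0 /=; apply: le_trans (gap_bound a b N).
apply: le_trans (Im_le_normc _); case: (exp_psum _ _) => c d /=.
by rewrite mul0r addr0.
Qed.

End cexp_series.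

(** * Evaluation at characters *)

Section ev.
Variables (R : realType) (V : zmodType).
Implicit Types (a b : ell1 R V) (phi : {additive V -> R}) (t : R).
Local Notation Re := (@complex.Re R).
Local Notation Im := (@complex.Im R).
Local Notation normc := (@ComplexField.Normc.normc R).

Lemma bd_cos (phi : V -> R) t : bd (fun v => cos (t * phi v)).
Proof. by exists 1 => v; exact: cos_max. Qed.

Lemma bd_sin (phi : V -> R) t : bd (fun v => sin (t * phi v)).
Proof. by exists 1 => v; exact: sin_max. Qed.

Definition ev (phi : V -> R) t a : R[i] :=
  us (fun v => a v * cos (t * phi v)) +i* us (fun v => a v * sin (t * phi v)).

Lemma us_coefD a b chi : bd chi -> us (fun v => (a + b) v * chi v) =
  us (fun v => a v * chi v) + us (fun v => b v * chi v).
Proof.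
move=> bchi; rewrite -usD; [|exact: sm_coef_bd..].
by apply: eq_us => v; rewrite -mulrDl.
Qed.

Lemma us_coefN a chi : bd chi -> us (fun v => (- a) v * chi v) =
  - us (fun v => a v * chi v).
Proof.
move=> bchi; rewrite -usN; last exact: sm_coef_bd.
by apply: eq_us => v; rewrite -mulNr.
Qed.

Fact ev_additive (phi : V -> R) t : zmod_morphism (ev phi t).
Proof.
move=> a b; rewrite /ev !us_coefD ?us_coefN //; try exact: bd_cos; exact: bd_sin.
Qed.

Lemma us_mulD a b (f g : V -> R) : bd f -> bd g -> forall c d : R,
  us (fun v => b v * (c * f v + d * g v)) =
  c * us (fun v => b v * f v) + d * us (fun v => b v * g v).
Proof.
move=> bf bg c d; rewrite -!usZ; [|exact: sm_coef_bd..].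
rewrite -usD; [|exact/smZ/sm_coef_bd..].
by apply: eq_us => v; ring.
Qed.

Fact ev_multiplicative phi t : monoid_morphism (ev phi t).
Proof.
split.
  by rewrite /ev !us_delta raddf0 mulr0 cos0 sin0.
move=> a b; have bc := bd_cos phi t; have bs := bd_sin phi t.
rewrite /ev !us_mul//.
have -> : us (fun u => a u * us (fun v => b v * cos (t * phi (u + v)))) =
   us (fun v => a v * (us (fun v => b v * cos (t * phi v)) * cos (t * phi v) +
      (- us (fun v => b v * sin (t * phi v))) * sin (t * phi v))).
  apply: eq_us => u; congr (_ * _).
  rewrite [_ * cos _]mulrC mulNr [_ * sin _]mulrC -mulNr -us_mulD//.
  by apply: eq_us => v; rewrite raddfD mulrDr cosD mulNr.
have -> : us (fun u => a u * us (fun v => b v * sin (t * phi (u + v)))) =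
   us (fun v => a v * (us (fun v => b v * cos (t * phi v)) * sin (t * phi v) +
      (us (fun v => b v * sin (t * phi v))) * cos (t * phi v))).
  apply: eq_us => u; congr (_ * _).
  rewrite [_ * sin _]mulrC [_ * cos _]mulrC -us_mulD//.
  by apply: eq_us => v; rewrite raddfD mulrDr sinD addrC; congr (_ * _); ring.
rewrite !us_mulD//; apply/eqP; rewrite eq_complex /=; apply/andP.
by split; apply/eqP; ring.
Qed.

HB.instance Definition _ phi t := GRing.isZmodMorphism.Build (ell1 R V) R[i]
  (ev phi t) (ev_additive phi t).
HB.instance Definition _ phi t := GRing.isMonoidMorphism.Build (ell1 R V) R[i]
  (ev phi t) (ev_multiplicative phi t).

Lemma evM phi t a b : ev phi t (a * b) = ev phi t a * ev phi t b.
Proof. exact: rmorphM. Qed.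

Lemma evX phi t a n : ev phi t (a ^+ n) = ev phi t a ^+ n.
Proof. exact: rmorphXn. Qed.

Lemma evD (phi : V -> R) t a b : ev phi t (a + b) = ev phi t a + ev phi t b.
Proof. by rewrite /ev !us_coefD//; [exact: bd_sin|exact: bd_cos]. Qed.

Lemma evN (phi : V -> R) t a : ev phi t (- a) = - ev phi t a.
Proof. by rewrite /ev !us_coefN//; [exact: bd_sin|exact: bd_cos]. Qed.

Lemma ev1 phi t : ev phi t (1 : ell1 R V) = 1.
Proof. exact: rmorph1. Qed.

Lemma ev_cst phi t c : ev phi t (cst V c) = c%:C.
Proof. by rewrite /ev !us_cst raddf0 mulr0 cos0 sin0 mulr1 mulr0. Qed.

Lemma ev_delta phi t v : ev phi t (delta R v) = cexp (0 +i* (t * phi v)).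
Proof. by rewrite /ev !us_delta /cexp expR0 !mul1r. Qed.

(** The factor 2 comes from bounding real and imaginary parts separately. It is the origin of
    [M := 2 * nrm a] in [ell1_inverse] and of [mu / 8] in [ell1_factor]. *)
Lemma normc_ev (phi : V -> R) t a : normc (ev phi t a) <= 2 * nrm a.
Proof.
apply: le_trans (normc_le _) _; rewrite /= mulr2n mulrDl mul1r -[nrm a]mulr1.
by apply: lerD; apply: us_coef_bd => v; [exact: cos_max|exact: sin_max].
Qed.

Lemma ev_asum (I : choiceType) (F : I -> ell1 R V) (phi : V -> R) t :
  sm (fun i => nrm (F i)) ->
  ev phi t (asum F) = us (fun i => Re (ev phi t (F i))) +i* us (fun i => Im (ev phi t (F i))).
Proof.
by move=> sF; rewrite /ev !us_asum//; [exact: bd_sin|exact: bd_cos].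
Qed.

Lemma sm_ev_Re (I : choiceType) (F : I -> ell1 R V) (phi : V -> R) t :
  sm (fun i => nrm (F i)) -> sm (fun i => Re (ev phi t (F i))).
Proof.
move=> sF; apply: (@sm_le _ _ _ (fun i => 2 * nrm (F i))); last exact: smZ.
by move=> i; apply: le_trans (Re_le_normc _) (normc_ev _ _ _).
Qed.

Lemma sm_ev_Im (I : choiceType) (F : I -> ell1 R V) (phi : V -> R) t :
  sm (fun i => nrm (F i)) -> sm (fun i => Im (ev phi t (F i))).
Proof.
move=> sF; apply: (@sm_le _ _ _ (fun i => 2 * nrm (F i))); last exact: smZ.
by move=> i; apply: le_trans (Im_le_normc _) (normc_ev _ _ _).
Qed.

End ev.

(** * Images of summable families under maps between groups *)

Section push.
Variables (R : realType) (V W : zmodType).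
Implicit Types (a b : ell1 R V) (g : {additive V -> W}).

Definition push (g : V -> W) a : ell1 R W := fam g (coef_sm a).

Lemma us_push (g : V -> W) a chi : bd chi ->
  us (fun w => push g a w * chi w) = us (fun v => a v * chi (g v)).
Proof. by move=> bchi; exact: us_fam. Qed.

Lemma ev_push (g : V -> W) (phi : W -> R) t a : ev phi t (push g a) = ev (phi \o g) t a.
Proof. by rewrite /ev !us_push//; [exact: bd_sin|exact: bd_cos]. Qed.

Lemma nrm_push (g : V -> W) a : nrm (push g a) <= nrm a.
Proof. exact: nrm_fam. Qed.

Lemma bd_comp (g : V -> W) (chi : W -> R) : bd chi -> bd (chi \o g).
Proof. by move=> [M HM]; exists M => v; exact: HM. Qed.

Fact push_additive (g : V -> W) : zmod_morphism (push g).
Proof.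
move=> a b; apply: ell1_ext => chi bchi.
rewrite us_push// !us_coefD ?us_coefN ?us_push//; exact: (bd_comp g bchi).
Qed.

Fact push_multiplicative g : monoid_morphism (push g).
Proof.
split; first by apply: ell1_ext => chi bchi; rewrite us_push// !us_delta raddf0.
move=> a b; apply: ell1_ext => chi bchi.
rewrite us_push// (us_mul a b (bd_comp g bchi)) us_mul//.
rewrite us_push; last exact: bd_inner.
apply: eq_us => u; congr (_ * _); rewrite us_push; last exact: bd_shift.
by apply: eq_us => v; rewrite /= raddfD.
Qed.

HB.instance Definition _ (g : V -> W) := GRing.isZmodMorphism.Build (ell1 R V) (ell1 R W)
  (push g) (push_additive g).
HB.instance Definition _ g := GRing.isMonoidMorphism.Build (ell1 R V) (ell1 R W)
  (push g) (push_multiplicative g).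

Lemma pushM g a b : push g (a * b) = push g a * push g b.
Proof. exact: rmorphM. Qed.

Lemma push_delta (g : V -> W) v : push g (delta R v) = delta R (g v).
Proof. by apply: ell1_ext => chi bchi; rewrite us_push// !us_delta. Qed.

Lemma push_cst g c : push g (cst V c) = cst W c.
Proof. by apply: ell1_ext => chi bchi; rewrite us_push// !us_cst raddf0. Qed.

End push.

(** * Power series in a summable family *)

Section power_series.
Variables (R : realType) (V : zmodType).
Implicit Types (a b x y : ell1 R V) (c : nat -> R).
Local Notation Re := (@complex.Re R).
Local Notation Im := (@complex.Im R).

Definition psA c x := asum (fun n => cst V (c n) * x ^+ n).
(** The norms of the powers are used rather than the powers of [nrm x], so that convergence is
    governed by the spectral radius of [x]. *)
Definition psA_ok c x := sm (fun n => c n * nrm (x ^+ n)).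

Lemma psA_okE c x : psA_ok c x -> sm (fun n => nrm (cst V (c n) * x ^+ n)).
Proof.
move=> /sm_abs; apply: eq_sm => n.
by rewrite nrmZ normrM (ger0_norm (nrm_ge0 _)).
Qed.

Lemma psA_ok_le c x (r : nat -> R) : (forall n, nrm (x ^+ n) <= r n) ->
  sm (fun n => c n * r n) -> psA_ok c x.
Proof.
move=> H /sm_abs; apply: sm_le => n; rewrite !normrM ler_wpM2l//.
rewrite ger0_norm ?nrm_ge0//; apply: le_trans (H n) (ler_norm _).
Qed.

Lemma us_nat_recl (f : nat -> R) : sm f -> us f = f 0%N + us (fun n => f n.+1).
Proof.
move=> sf; have sg : sm (fun n => f n.+1) by apply: (@sm_inj _ _ _ succn f) => // m n [].
have := us_nat sf; rewrite -(cvg_shiftS (series f)) => /cvg_lim <-//.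
apply/cvg_lim => //; rewrite (_ : (fun n => _) = (fun n => f 0%N + series (fun k => f k.+1) n)).
  by apply: cvgD; [exact: cvg_cst|exact: us_nat].
by apply/funext => n; rewrite /series /= big_nat_recl.
Qed.

Lemma asum_recl (F : nat -> ell1 R V) : sm (fun n => nrm (F n)) ->
  asum F = F 0%N + asum (fun n => F n.+1).
Proof.
move=> sF; apply: ell1P => v.
have sG : sm (fun n => nrm (F n.+1)) by apply: (@sm_inj _ _ _ succn (fun n => nrm (F n))) => // m n [].
rewrite coefD !coef_asum// us_nat_recl//; exact: sm_coef_i.
Qed.

Lemma psA_recl c x : psA_ok c x -> psA_ok (fun n => c n.+1) x ->
  psA c x = cst V (c 0%N) + x * psA (fun n => c n.+1) x.
Proof.
move=> ok ok'; rewrite [LHS]asum_recl; last exact: psA_okE.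
rewrite expr0 mulr1; congr (_ + _); rewrite mul_asum; last exact: psA_okE.
by congr asum; apply/funext => n; rewrite mulrCA exprS.
Qed.

Lemma ev_psA c x (phi : {additive V -> R}) t : psA_ok c x ->
  ev phi t (psA c x) = us (fun n => Re ((c n)%:C * ev phi t x ^+ n)) +i*
    us (fun n => Im ((c n)%:C * ev phi t x ^+ n)).
Proof.
move=> ok; rewrite ev_asum; last exact: psA_okE.
have E n : ev phi t (cst V (c n) * x ^+ n) = (c n)%:C * ev phi t x ^+ n.
  by rewrite evM evX ev_cst.
by congr Complex; apply: eq_us => n; rewrite -E.
Qed.

End power_series.

Section exponential.
Variables (R : realType) (V : zmodType).
Implicit Types (x y : ell1 R V).

Definition expA x := psA (fun n => (n`!%:R)^-1) x.

Lemma sm_exp_coeff (r : R) : sm (fun n => (n`!%:R)^-1 * r ^+ n).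
Proof.
apply: sm_nat; rewrite (_ : (fun n => _) = exp_coeff `|r|).
  exact: is_cvg_series_exp_coeff.
by apply/funext => n; rewrite /exp_coeff /= normrM normfV normr_nat normrX mulrC.
Qed.

Lemma expA_ok x : psA_ok (fun n => (n`!%:R)^-1) x.
Proof. exact: psA_ok_le (nrmX x) (sm_exp_coeff _). Qed.

Lemma ev_expA (phi : {additive V -> R}) t x : ev phi t (expA x) = cexp (ev phi t x).
Proof.
rewrite ev_psA; last exact: expA_ok.
set z := ev phi t x.
have E n : ((n`!%:R)^-1)%:C * z ^+ n = z ^+ n / n`!%:R.
  by rewrite mulrC fmorphV rmorph_nat.
have sok := psA_okE (expA_ok x).
have sR := sm_ev_Re phi t sok; have sI := sm_ev_Im phi t sok.
have hR n : complex.Re (ev phi t (cst V (n`!%:R)^-1 * x ^+ n)) = complex.Re (z ^+ n / n`!%:R).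
  by rewrite evM evX ev_cst E.
have hI n : complex.Im (ev phi t (cst V (n`!%:R)^-1 * x ^+ n)) = complex.Im (z ^+ n / n`!%:R).
  by rewrite evM evX ev_cst E.
have {}sR := eq_sm hR sR; have {}sI := eq_sm hI sI.
under eq_us do rewrite E.
under [X in _ +i* X]eq_us do rewrite E.
rewrite [RHS](_ : _ = complex.Re (cexp z) +i* complex.Im (cexp z)); last by case: (cexp z).
congr Complex.
  apply: (cvg_unique (@Rhausdorff R) (us_nat sR)).
  rewrite (_ : series _ = (fun N => complex.Re (exp_psum N z))); first exact: cvg_exp_psum_Re.
  apply/funext => N; rewrite /series /= big_mkord /exp_psum.
  by apply/esym/(big_morph (@complex.Re R)) => // -[u v] [u' v'].
apply: (cvg_unique (@Rhausdorff R) (us_nat sI)).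
rewrite (_ : series _ = (fun N => complex.Im (exp_psum N z))); first exact: cvg_exp_psum_Im.
apply/funext => N; rewrite /series /= big_mkord /exp_psum.
by apply/esym/(big_morph (@complex.Im R)) => // -[u v] [u' v'].
Qed.

End exponential.

(** * Derivations *)

Section derivations.
Variables (R : realType) (V : zmodType).
Implicit Types (a b x : ell1 R V) (c : nat -> R).

Lemma coefM a b v : (a * b) v = us (fun u => a u * b (v - u)).
Proof.
rewrite -[LHS]us_ind (us_mul a b (bd1 R v)); apply: eq_us => u; congr (_ * _).
rewrite -[RHS]us_ind; apply: eq_us => w; congr (_ * _%:R); congr nat_of_bool.
by apply/eqP/eqP => [<-|->]; rewrite addrC ?addKr ?addrK ?subrK.
Qed.

Lemma sm_coefM a b v : sm (fun u => a u * b (v - u)).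
Proof.
apply: (@sm_bd _ _ _ _ (nrm b)); first exact: coef_sm.
by move=> u; exact: coef_le_nrm.
Qed.

(* [a'] is the image of [a] under the derivation multiplying the coefficient at
   [v] by [psi v], which is only partially defined on summable families. *)
Definition isD (psi : V -> R) a a' := forall v, a' v = psi v * a v.

Lemma isD_add psi a b a' b' : isD psi a a' -> isD psi b b' -> isD psi (a + b) (a' + b').
Proof. by move=> Da Db v; rewrite !coefD Da Db mulrDr. Qed.

Lemma isD_opp psi a a' : isD psi a a' -> isD psi (- a) (- a').
Proof. by move=> Da v; rewrite !coefN Da mulrN. Qed.

Lemma isD_eq psi a a' a'' : isD psi a a' -> a' = a'' -> isD psi a a''.
Proof. by move=> + <-. Qed.

(** Additivity splits [psi v] as [psi u + psi (v - u)] in each term of the convolution: this is the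
    Leibniz rule. *)
Lemma isD_mul (psi : {additive V -> R}) a b a' b' :
  isD psi a a' -> isD psi b b' -> isD psi (a * b) (a' * b + a * b').
Proof.
move=> Da Db v; rewrite coefD !coefM -usD; [|exact: sm_coefM..].
rewrite -usZ; last exact: sm_coefM.
by apply: eq_us => u; rewrite Da Db raddfB; ring.
Qed.

Lemma isD_cst (psi : {additive V -> R}) r : isD psi (cst V r) 0.
Proof.
by move=> v; rewrite /= ; case: eqVneq => [->|_]; rewrite ?raddf0 !(mul0r, mulr0).
Qed.

Lemma isD1 (psi : {additive V -> R}) : isD psi 1 0.
Proof. by rewrite -(rmorph1 (cst V : R -> ell1 R V)); exact: isD_cst. Qed.

Lemma isD_delta psi v : isD psi (delta R v) (cst V (psi v) * delta R v).
Proof.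
by move=> u; rewrite coefZ /=; case: eqVneq => [->//|_]; rewrite !mulr0.
Qed.

Lemma isD_scale psi r a a' : isD psi a a' -> isD psi (cst V r * a) (cst V r * a').
Proof. by move=> Da v; rewrite !coefZ Da mulrCA. Qed.

Lemma isD_exp (psi : {additive V -> R}) a a' n : isD psi a a' ->
  isD psi (a ^+ n.+1) (cst V n.+1%:R * a ^+ n * a').
Proof.
move=> Da; elim: n => [|n IH].
  by rewrite expr1 expr0 rmorph1 !mul1r.
rewrite exprS; apply: isD_eq (isD_mul Da IH) _.
by rewrite -[n.+2%:R]natr1 rmorphD rmorph1 !exprS; ring.
Qed.

(** Differentiation acts on each coefficient by a scalar, so it passes through the sum over [n]
    without any limit argument. The constant term is killed, which shifts the index by one. *)
Lemma isD_psA (psi : {additive V -> R}) c x x' : isD psi x x' -> psA_ok c x ->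
  psA_ok (fun n => n.+1%:R * c n.+1) x ->
  isD psi (psA c x) (psA (fun n => n.+1%:R * c n.+1) x * x').
Proof.
move=> Dx ok ok' v.
have s1 := psA_okE ok; have s2 := psA_okE ok'.
rewrite mulrC mul_asum// [RHS](_ : _ = psi v * us (fun n => (cst V (c n) * x ^+ n) v)); last first.
  by rewrite coef_asum.
rewrite -usZ; last exact: sm_coef_i s1.
have s3 := smZ (psi v) (sm_coef_i v s1).
rewrite (us_nat_recl s3) expr0 mulr1 coef_asum; last exact: sm_nrmM.
rewrite [X in _ = X + _](_ : _ = 0) ?add0r; last by rewrite -(isD_cst psi (c 0%N)).
apply: eq_us => n.
transitivity (psi v * (cst V (c n.+1) * x ^+ n.+1) v); last by [].
rewrite [in RHS]coefZ [in RHS]mulrCA; transitivity (c n.+1 * (cst V n.+1%:R * x ^+ n * x') v).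
  2: by congr (_ * _); exact: (isD_exp n Dx v).
rewrite -coefZ rmorphM.
by congr (coef _ v); ring.
Qed.

Lemma neumann x : psA_ok (fun=> 1) x -> (1 - x) * psA (fun=> 1) x = 1.
Proof.
move=> ok; have := psA_recl ok ok; rewrite rmorph1.
move: (psA _ _) => g Hg; rewrite mulrBl mul1r {1}Hg; ring.
Qed.

End derivations.

(** * Elementary estimates: polynomial against exponential growth, sums of cosines *)

Section growth.
Variable R : realType.

Lemma sm_geometric (r : R) : 0 <= r -> r < 1 -> sm (fun n => r ^+ n).
Proof.
move=> r0 r1; apply: sm_nat; rewrite (_ : (fun n => _) = geometric 1 r).
  by apply: is_cvg_geometric_series; rewrite ger0_norm.
by apply/funext => n; rewrite /= mul1r ger0_norm// exprn_ge0.
Qed.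

(** Each factor [n.+1] is absorbed by Bernoulli's inequality when the ratio grows from the midpoint
    of [r] and [r'] to [r']; the induction handles the other factors below the midpoint. *)
Lemma poly_exp_bound d (r r' : R) : 0 <= r -> r < r' -> exists2 C, 0 <= C &
  forall n, n.+1%:R ^+ d * r ^+ n <= C * r' ^+ n.
Proof.
elim: d r r' => [|d IH] r r' r0 rr'.
  exists 1 => // n; rewrite expr0 !mul1r lerXn2r ?nnegrE//; last exact: ltW.
  by apply: le_trans r0 (ltW _).
have [|C C0 HC] := IH r ((r + r') / 2) r0; first by lra.
have s0 : 0 < (r + r') / 2 by lra.
have sr : (r + r') / 2 < r' by lra.
move: ((r + r') / 2) s0 sr HC => s s0 sr HC.
pose y := r' / s - 1; have y0 : 0 < y by rewrite subr_gt0 ltr_pdivlMr// mul1r.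
(* With [r' = (1 + y) * s], the factor [1 + y^-1] is chosen so that
   [n + 1 <= (1 + y^-1) * (1 + n y)]; the difference is [n y + y^-1]. *)
exists (C * (1 + y^-1)); first by rewrite mulr_ge0// addr_ge0// invr_ge0 ltW.
move=> n; rewrite exprS -mulrA; apply: (@le_trans _ _ (n.+1%:R * (C * s ^+ n))).
  by apply: ler_wpM2l => //; exact: HC.
rewrite mulrCA -mulrA ler_wpM2l//.
have -> : r' = (1 + y) * s by rewrite /y addrC subrK divfK// gt_eqF.
rewrite exprMn mulrA ler_wpM2r//; first exact/exprn_ge0/ltW.
have Hb : 1 + n%:R * y <= (1 + y) ^+ n.
  elim: n => [|n IHn]; first by rewrite mul0r addr0 expr0.
  rewrite exprS; apply: (@le_trans _ _ ((1 + y) * (1 + n%:R * y))).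
    rewrite -natr1 -subr_ge0 (_ : _ - _ = n%:R * y ^+ 2); last by ring.
    by rewrite mulr_ge0// sqr_ge0.
  by rewrite ler_wpM2l// addr_ge0// ltW.
apply: (@le_trans _ _ ((1 + y^-1) * (1 + n%:R * y))).
  rewrite -natr1 -subr_ge0 (_ : _ - _ = n%:R * y + y^-1); last by field; rewrite gt_eqF.
  by rewrite addr_ge0 ?invr_ge0 ?mulr_ge0// ltW.
by rewrite ler_wpM2l// addr_ge0// invr_ge0 ltW.
Qed.

Lemma sin_neq0 (x : R) : x != 0 -> `|x| < 1 -> sin x != 0.
Proof.
have H (y : R) : 0 < y -> y < 1 -> sin y != 0.
  move=> y0 y1; rewrite gt_eqF// sin_gt0_pi// y0 /=.
  by apply: lt_le_trans y1 _; apply: le_trans (pi_ge2 R); rewrite ler1n.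
rewrite neq_lt => /orP[x0|x0]; last by rewrite gtr0_norm//; exact: H.
by rewrite ltr0_norm// => x1; rewrite -[x]opprK sinN oppr_eq0; apply: H; rewrite // oppr_gt0.
Qed.

(** Multiplying by [2 sin (x / 2)] makes the sum telescope. As the bound is independent of [N], a
    nontrivial frequency has mean 0. *)
Lemma sum_cos_bound (x : R) N : sin (x / 2) != 0 ->
  `|\sum_(n < N) cos (n%:R * x)| <= `|sin (x / 2)|^-1.
Proof.
move=> s0; have E : 2 * sin (x / 2) * (\sum_(n < N) cos (n%:R * x)) =
    sin (N%:R * x - x / 2) + sin (x / 2).
  elim: N => [|N IH]; first by rewrite big_ord0 mulr0 mul0r sub0r sinN addNr.
  rewrite big_ord_recr /= mulrDr IH.
  have -> : N.+1%:R * x - x / 2 = N%:R * x + x / 2 by rewrite -natr1; field.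
  by rewrite !sinD cosN sinN; ring.
rewrite -[leRHS]mul1r ler_pdivlMr ?normr_gt0// -normrM mulrC.
rewrite -(ler_pM2l (_ : 0 < 2))// -[X in X * `|_|](@ger0_norm _ 2)// -normrM mulrA E mulr1.
by apply: le_trans (ler_normD _ _) _; rewrite mulr2n lerD// sin_max.
Qed.

End growth.

(** * The spectral radius *)

Section spectral_radius.
Variables (R : realType) (V : zmodType) (phi : {additive V -> R}).
Hypothesis phi_inj : injective phi.
Implicit Types (a b : ell1 R V).
Local Notation normc := (@ComplexField.Normc.normc R).

(* The coefficient at 0 is the limit of the means of Re (ev a) over the points
   n h, n < N, for a step h such that no other frequency is trivial on h. *)
Lemma coef0_le_fin (J : {fset V}) a r : (forall v, v \notin J -> a v = 0) ->
  (forall t, normc (ev phi t a) <= r) -> `|a 0| <= r.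
Proof.
move=> aJ ar.
pose J' := (J `\ 0)%fset.
(* [K] exceeds every frequency in modulus, so with [h = 2 / K] each half-angle
   [h * phi v / 2 = phi v / K] is nonzero and less than 1 in modulus, where [sin] does not
   vanish. *)
pose K := 1 + \sum_(v <- J') `|phi v|.
have K0 : 0 < K by rewrite ltr_pwDl// sumr_ge0.
pose h := 2 / K.
have phiK v : v \in J' -> `|phi v| < K.
  by move=> vJ; rewrite /K (big_fsetD1 v)//= addrCA ltrDl ltr_pwDl// sumr_ge0.
have hs v : v \in J' -> sin (h * phi v / 2) != 0.
  move=> vJ; have v0 : v != 0 by move: vJ; rewrite !inE => /andP[].
  have pv : phi v != 0 by apply: contraNneq v0 => pv0; apply/eqP/phi_inj; rewrite raddf0.
  rewrite (_ : h * phi v / 2 = phi v / K); last by rewrite /h; field; rewrite gt_eqF.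
  apply: sin_neq0; first by rewrite mulf_neq0// invr_neq0// gt_eqF.
  by rewrite normrM normfV (gtr0_norm K0) ltr_pdivrMr// mul1r phiK.
pose B := \sum_(v <- J') `|a v| * `|sin (h * phi v / 2)|^-1.
(* Since [B] does not depend on [N], a large [N] excludes [r < |a 0|]. *)
have key N : N%:R * `|a 0| <= N%:R * r + B.
  have E : \sum_(n < N) complex.Re (ev phi (n%:R * h) a) = N%:R * a 0 +
      \sum_(v <- J') a v * \sum_(n < N) cos (n%:R * (h * phi v)).
    under [in RHS]eq_bigr do rewrite mulr_sumr.
    rewrite exchange_big /= [N%:R * _](_ : _ = \sum_(n < N) a 0); last first.
      by rewrite mulr_natl sumr_const card_ord.
    rewrite -big_split; apply: eq_bigr => n _ /=.
    rewrite (@us_fin _ _ _ (0 |` J')%fset _).2; last first.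
      move=> v; rewrite !inE; case: eqVneq => //= _ /aJ ->; by rewrite mul0r.
    rewrite big_fsetU1 ?inE ?eqxx//= raddf0 mulr0 cos0 mulr1; congr (_ + _).
    by apply: eq_bigr => v _; rewrite mulrA.
  have -> : N%:R * `|a 0| = `|N%:R * a 0| by rewrite normrM normr_nat.
  have -> : N%:R * a 0 = \sum_(n < N) complex.Re (ev phi (n%:R * h) a) -
      \sum_(v <- J') a v * \sum_(n < N) cos (n%:R * (h * phi v)) by rewrite E addrK.
  apply: le_trans (ler_normB _ _) _; apply: lerD.
    apply: le_trans (ler_norm_sum _ _ _) _.
    rewrite mulr_natl -[X in _ *+ X]card_ord -sumr_const; apply: ler_sum => n _.
    exact: le_trans (Re_le_normc _) (ar _).
  apply: le_trans (ler_norm_sum _ _ _) _.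
  rewrite /B big_seq [leRHS]big_seq; apply: ler_sum => v vJ.
  by rewrite normrM ler_wpM2l//; apply: sum_cos_bound; exact: hs.
rewrite leNgt; apply/negP => ra.
have B0 : 0 <= B by apply: sumr_ge0 => v _; rewrite mulr_ge0// invr_ge0.
have := archi_boundP (divr_ge0 B0 (ltW (_ : 0 < `|a 0| - r))); rewrite subr_gt0 => /(_ ra).
move: (Num.bound _) => N; rewrite ltr_pdivrMr ?subr_gt0// mulrBr.
by have := key N; lra.
Qed.

(** Multiplication by [delta R (- w)] brings the coefficient at [w] to 0 and changes the transform
    by a factor of modulus 1 only. *)
Lemma coef_le_fin (J : {fset V}) a r : (forall v, v \notin J -> a v = 0) ->
  (forall t, normc (ev phi t a) <= r) -> forall w, `|a w| <= r.
Proof.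
move=> aJ ar w; have -> : a w = (delta R (- w) * a) 0 by rewrite coefM_delta opprK add0r.
apply: (@coef0_le_fin [fset v - w | v in J]%fset) => [v vJ|t].
  rewrite coefM_delta opprK; apply: aJ; apply: contra vJ => vJ.
  by apply/imfsetP; exists (v + w); rewrite ?addrK.
rewrite evM ComplexField.Normc.normcM ev_delta; apply: le_trans (ar t).
rewrite /cexp expR0 !mul1r /= cos2Dsin2 sqrtr1 mul1r//.
Qed.

Section trigonometric_polynomial.
Variables (J : {fset V}) (P : ell1 R V).
Hypothesis PJ : forall v, v \notin J -> P v = 0.

(** An [n]-fold sum of elements of [J] depends only on the multiplicities, each at most [n].
    Counting multiplicities instead of sequences is what makes the count polynomial in [n]. *)
Let freq n (m : {ffun J -> 'I_n.+1}) : V := \sum_(j : J) (val j) *+ (m j).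

Let supp_exp n w : (P ^+ n) w != 0 -> exists m, w = @freq n m.
Proof.
elim: n w => [|n IH] w.
  rewrite expr0; have [w0 _|w0] := eqVneq w 0; last by rewrite /= (negPf w0) eqxx.
  by rewrite w0; exists [ffun=> ord0]; rewrite /freq big1// => j _; rewrite ffunE mulr0n.
rewrite exprS coefM => H.
have [u Pu Pw] : exists2 u, P u != 0 & (P ^+ n) (w - u) != 0.
  apply: contrapT => H1; move/eqP: H; apply.
  rewrite -[RHS](@us0 R V); apply: eq_us => u; apply/eqP; rewrite mulf_eq0.
  by apply: contra_notT H1; rewrite negb_or => /andP[? ?]; exists u.
have uJ : u \in J by apply: contraNT Pu => /PJ->.
have [m Em] := IH _ Pw.
have mlt (j : J) : (m j + (val j == u) < n.+2)%N.
  by rewrite -[n.+2]addn1 -addSn leq_add ?leq_b1//; exact: ltn_ord.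
exists [ffun j => Ordinal (mlt j)]; rewrite /freq.
under eq_bigr do rewrite ffunE /= mulrnDr.
rewrite big_split /= -[X in _ = X + _]Em.
rewrite (bigD1 [` uJ]%fset)//= eqxx mulr1n big1 ?addr0 ?subrK//.
by move=> j; rewrite -val_eqE /= => /negPf->; rewrite mulr0n.
Qed.

Lemma nrm_trig_exp r : (forall t, normc (ev phi t P) <= r) ->
  forall n, nrm (P ^+ n) <= n.+1%:R ^+ #|` J| * r ^+ n.
Proof.
move=> Pr n; pose T := [fset freq m | m in {: {ffun J -> 'I_n.+1}}]%fset.
have PT v : v \notin T -> (P ^+ n) v = 0.
  apply: contraNeq => /supp_exp[m ->].
  by apply/imfsetP; exists m.
have r0 : 0 <= r by apply: le_trans (Pr 0); exact: normc_ge0.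
have Pn t : normc (ev phi t (P ^+ n)) <= r ^+ n.
  rewrite evX; elim: n {T PT} => [|n IH].
    by rewrite !expr0 /= expr1n expr0n addr0 sqrtr1.
  by rewrite !exprS ComplexField.Normc.normcM ler_pM ?normc_ge0.
rewrite /nrm (@us_fin _ _ _ T _).2; last by move=> v /PT->; rewrite normr0.
apply: (@le_trans _ _ (\sum_(v <- T) r ^+ n)).
  by apply: ler_sum => v _; exact: coef_le_fin PT Pn v.
rewrite big_const_seq count_predT iter_addr_0 -[X in X <= _]mulr_natl ler_wpM2r ?exprn_ge0//.
rewrite -natrX ler_nat.
apply: (@leq_trans #|{: {ffun J -> 'I_n.+1}}|).
  by apply: leq_trans (leq_imfset_card _ _ _) _; rewrite /= cardE.
by rewrite card_ffun card_ord cardfE.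
Qed.

End trigonometric_polynomial.

Definition trunc (J : {fset V}) a : ell1 R V := \sum_(v <- J) cst V (a v) * delta R v.

Lemma coef_trunc J a v : trunc J a v = if v \in J then a v else 0.
Proof.
rewrite coef_sum; under eq_bigr do rewrite coefZ /=.
case: ifP => vJ.
  rewrite (big_fsetD1 v)//= eqxx mulr1 big_seq big1 ?addr0// => u.
  by rewrite !inE => /andP[/negPf uv _]; rewrite eq_sym uv mulr0.
rewrite big_seq big1// => u uJ; case: eqVneq => [vu|]; last by rewrite mulr0.
by rewrite vu uJ in vJ.
Qed.

Lemma trunc_approx a e : 0 < e -> exists J, nrm (a - trunc J a) <= e.
Proof.
move=> e0; have sa := sm_abs (coef_sm a).
have /cvgrPdist_lt /(_ e e0) [J _ HJ] := us_cvg sa.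
exists J; rewrite /nrm.
have -> : us (fun v => `|(a - trunc J a) v|) =
    us (fun v => `|a v| - (if v \in J then `|a v| else 0)).
  apply: eq_us => v; rewrite coefD coefN coef_trunc; case: ifP => _.
    by rewrite !subrr normr0.
  by rewrite !subr0.
have [s1 s2] := @us_fin _ _ (fun v => if v \in J then `|a v| else 0) J
   (fun v => ltac:(move=> /negPf->; exact: erefl)).
rewrite usB// s2; apply: ltW; apply: le_lt_trans (HJ J _) => /=; last exact: fsubset_refl.
rewrite partial_sumE big_seq [X in _ <= `|_ - X|]big_seq.
rewrite (eq_bigr (fun v => `|a v|)) ?ler_norm// => v vJ; by rewrite vJ.
Qed.

(** Split [a = P + Q] with [P] of finite support and [nrm Q <= e]. In the binomial expansion of
    [a ^+ n] all polynomial factors coming from powers of [P] are bounded by the one for [n], and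
    what remains sums to the [n]-th power of [(r + 2 * e) + e]. *)
Lemma spectral_bound a r r' : r < r' -> (forall t, normc (ev phi t a) <= r) ->
  exists2 C, 0 <= C & forall n, nrm (a ^+ n) <= C * r' ^+ n.
Proof.
move=> rr' ar; have r0 : 0 <= r by apply: le_trans (ar 0); exact: normc_ge0.
(* A quarter, so that [r + 3 * e < r']: two [e] bound the transform of [Q] by [normc_ev], and the
   third is [nrm Q] itself. *)
pose e := (r' - r) / 4.
have e0 : 0 < e by rewrite /e; lra.
have [J HJ] := trunc_approx a e0.
set P := trunc J a in HJ; pose Q := a - P.
have aE : a = P + Q by rewrite /Q addrC subrK.
have Pr t : normc (ev phi t P) <= r + 2 * e.
  have -> : ev phi t P = ev phi t a + ev phi t (- Q) by rewrite -evD; congr ev; rewrite aE; ring.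
  apply: le_trans (le_normcD _ _) (lerD (ar t) _).
  by apply: le_trans (normc_ev _ _ _) _; rewrite nrmN ler_wpM2l.
have PJ v : v \notin J -> P v = 0 by move=> /negPf vJ; rewrite coef_trunc vJ.
have HP := nrm_trig_exp PJ Pr.
have [||C C0 HC] := @poly_exp_bound _ #|` J| (r + 3 * e) r'.
- by rewrite addr_ge0// mulr_ge0// ltW.
- by rewrite /e; lra.
exists C => // n; apply: le_trans (HC n).
rewrite aE exprDn; apply: le_trans (nrm_sum _ _ _) _.
have -> : r + 3 * e = (r + 2 * e) + e by ring.
rewrite [in leRHS]exprDn mulr_sumr; apply: ler_sum => i _.
have -> : (P ^+ (n - i) * Q ^+ i) *+ 'C(n, i) = cst V 'C(n, i)%:R * (P ^+ (n - i) * Q ^+ i).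
  by rewrite rmorph_nat mulr_natl.
rewrite nrmZ normr_nat -[X in _ <= _ * X]mulr_natl [leRHS]mulrCA ler_wpM2l//.
apply: le_trans (nrmM _ _) _; rewrite mulrA; apply: ler_pM; rewrite ?nrm_ge0//.
  apply: le_trans (HP _) _; apply: ler_wpM2r; first by rewrite exprn_ge0// addr_ge0// mulr_ge0// ltW.
  by rewrite lerXn2r ?nnegrE// ler_nat ltnS leq_subr.
by apply: le_trans (nrmX _ _) _; rewrite lerXn2r ?nnegrE ?nrm_ge0// ltW.
Qed.

End spectral_radius.

(** * Inverses and logarithms *)

Section conjugate.
Variables (R : realType) (V : zmodType).
Implicit Types (a : ell1 R V).

Definition adj a := push (fun v : V => - v) a.

Lemma coef_adj a v : adj a v = a (- v).
Proof.
rewrite -[LHS]us_ind (us_push _ a (bd1 R v)) -[RHS]us_ind; apply: eq_us => w.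
by rewrite eqr_oppLR.
Qed.

Lemma ev_adj (phi : {additive V -> R}) t a : ev phi t (adj a) = (ev phi t a)^*.
Proof.
rewrite ev_push /ev /=.
have -> : us (fun v => a v * cos (t * phi (- v))) = us (fun v => a v * cos (t * phi v)).
  by apply: eq_us => v; rewrite raddfN mulrN cosN.
congr (_ +i* _); rewrite -usN; last exact/sm_coef_bd/bd_sin.
by apply: eq_us => v; rewrite raddfN mulrN sinN mulrN.
Qed.

Lemma isD_adj (psi : {additive V -> R}) a a' : isD psi a a' -> isD psi (adj a) (- adj a').
Proof. by move=> Da v; rewrite coefN !coef_adj Da raddfN mulNr opprK. Qed.

End conjugate.

Section inverse.
Variables (R : realType) (V : zmodType) (phi : {additive V -> R}).
Hypothesis phi_inj : injective phi.
Implicit Types (a b x : ell1 R V).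
Local Notation normc := (@ComplexField.Normc.normc R).

Lemma psA_ok_spectral x r : r < 1 -> (forall t, normc (ev phi t x) <= r) ->
  forall d (c : nat -> R), (forall n, `|c n| <= n.+1%:R ^+ d) -> psA_ok c x.
Proof.
move=> r1 xr d c cd; have r0 : 0 <= r by apply: le_trans (xr 0); exact: normc_ge0.
(* The two points dividing the interval from [r] to 1 in thirds: the first absorbs the loss in
   [spectral_bound], the second the factor of degree [d]. *)
have rs : r < (2 * r + 1) / 3 by lra.
have [C C0 HC] := spectral_bound phi_inj rs xr.
have [||D D0 HD] := @poly_exp_bound _ d ((2 * r + 1) / 3) ((r + 2) / 3); [by lra..|].
apply: (@sm_le _ _ _ (fun n => C * D * ((r + 2) / 3) ^+ n)); last first.
  by apply/smZ/sm_geometric; lra.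
move=> n; rewrite normrM (ger0_norm (nrm_ge0 _)).
apply: le_trans (ler_wpM2r (nrm_ge0 _) (cd n)) _.
apply: le_trans (ler_wpM2l _ (HC n)) _; first by rewrite exprn_ge0.
by rewrite mulrCA -mulrA; apply: ler_wpM2l.
Qed.

(** A form of Wiener's lemma. The inverse is an explicit Neumann series, which shows moreover that a
    derivation defined at [a] is defined at [b]; [winding] relies on this. *)
Lemma ell1_inverse a mu : 0 < mu -> (forall t, mu <= normc (ev phi t a)) ->
  exists2 b, a * b = 1 & forall (psi : {additive V -> R}) a',
    isD psi a a' -> exists b', isD psi b b'.
Proof.
move=> mu0 amu; pose M := 2 * nrm a.
have muM : mu <= M by apply: le_trans (amu 0) (normc_ev _ _ _).
have M0 : 0 < M by apply: lt_le_trans muM.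
have M20 : 0 < M ^+ 2 by rewrite exprn_gt0.
(* The transform of [a * adj a] is the squared modulus, between [mu ^+ 2] and [M ^+ 2], so that of
   [e] is real, between 0 and [1 - mu ^+ 2 / M ^+ 2]. *)
pose e := 1 - cst V (M ^- 2) * (a * adj a).
have er t : normc (ev phi t e) <= 1 - mu ^+ 2 / M ^+ 2.
  have -> : ev phi t e = (1 - (normc (ev phi t a)) ^+ 2 / M ^+ 2)%:C.
    rewrite evD evN ev1 !evM ev_cst ev_adj.
    case: (ev phi t a) => u v /=; rewrite sqr_sqrtr ?addr_ge0 ?sqr_ge0//.
    by apply/eqP; rewrite eq_complex /=; apply/andP; split; apply/eqP; ring.
  rewrite normcR ger0_norm.
    by rewrite lerD2l lerN2 ler_pM2r ?invr_gt0// lerXn2r ?nnegrE ?normc_ge0// ltW.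
  rewrite subr_ge0 ler_pdivrMr// mul1r lerXn2r ?nnegrE ?normc_ge0//; first exact: ltW.
  exact: normc_ev.
have r1 : 1 - mu ^+ 2 / M ^+ 2 < 1 by rewrite ltrBlDr ltrDl divr_gt0// exprn_gt0.
have ok : psA_ok (fun=> 1) e.
  by apply: (psA_ok_spectral r1 er (d := 0)) => n; rewrite normr1 expr0.
(* Convergence of the derived geometric series, for differentiating the inverse. *)
have ok' : psA_ok (fun n => n.+1%:R * 1) e.
  apply: (psA_ok_spectral r1 er (d := 1)) => n; by rewrite mulr1 normr_nat expr1.
exists (cst V (M ^- 2) * (adj a * psA (fun=> 1) e)).
  by rewrite -(neumann ok) /e; ring.
move=> psi a' Da; have Da2 := isD_adj Da.
have De := isD_add (isD1 psi) (isD_opp (isD_scale (M ^- 2) (isD_mul Da Da2))).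
eexists; apply: isD_scale; apply: isD_mul Da2 _.
exact: isD_psA De ok ok'.
Qed.

End inverse.

Lemma ev_log (R : realType) (V : zmodType) (phi : {additive V -> R}) t (x L : ell1 R V) :
  (1 + x) * expA (- L) = 1 -> 1 + ev phi t x = cexp (ev phi t L).
Proof.
move=> /(congr1 (ev phi t)); rewrite evM ev_expA evD !ev1 evN => H.
by rewrite -[RHS]mul1r -[X in _ = X * _]H -mulrA -cexpD addNr cexp0 mulr1.
Qed.

Section logarithm.
Variables (R : realType) (V : zmodType) (phi : {additive V -> R}).
Hypothesis phi_inj : injective phi.
Local Notation normc := (@ComplexField.Normc.normc R).
Local Notation VZ := (V * int)%type.
Implicit Types (a b x y : ell1 R VZ).

Definition posdeg a := forall w, w.2 <= 0 -> a w = 0.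

Lemma posdegM a b : posdeg a -> posdeg b -> posdeg (a * b).
Proof.
move=> pa pb w w0; rewrite coefM -[RHS](@us0 R VZ); apply: eq_us => u.
have [u0|u0] := lerP u.2 0; first by rewrite pa// mul0r.
by rewrite pb ?mulr0//= subr_le0 (le_trans w0)// ltW.
Qed.

Lemma posdegX a n : posdeg a -> posdeg (a ^+ n.+1).
Proof.
move=> pa; elim: n => [|n IH]; first by rewrite expr1.
by rewrite exprS; exact: posdegM.
Qed.

Lemma posdegZ r a : posdeg a -> posdeg (cst VZ r * a).
Proof. by move=> pa w w0; rewrite coefZ pa// mulr0. Qed.

Lemma posdeg_asum (F : nat -> ell1 R VZ) : sm (fun n => nrm (F n)) ->
  (forall n, posdeg (F n)) -> posdeg (asum F).
Proof.
move=> sF pF w w0; rewrite coef_asum// -[RHS](@us0 R nat); apply: eq_us => n.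
exact: pF.
Qed.

Lemma posdeg_psA (c : nat -> R) y : psA_ok c y -> posdeg y -> posdeg (psA c y - cst VZ (c 0%N)).
Proof.
move=> /psA_okE ok py; rewrite /psA asum_recl// expr0 mulr1 addrC addKr.
apply: posdeg_asum => [|n]; last exact/posdegZ/posdegX.
by apply: (@sm_inj _ _ _ succn (fun n => nrm (cst VZ (c n) * y ^+ n))) => // m n [].
Qed.

Definition deg (w : VZ) : R := w.2%:~R.
Fact deg_additive : zmod_morphism deg.
Proof. by move=> u v; rewrite /deg /= rmorphB. Qed.
HB.instance Definition _ := GRing.isZmodMorphism.Build VZ R deg deg_additive.

Definition degree0 (v : V) : VZ := (v, 0).
Fact degree0_additive : zmod_morphism degree0.
Proof. by move=> u v; rewrite /degree0 /= -[RHS]/(u - v, 0 - 0) subr0. Qed.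
HB.instance Definition _ := GRing.isZmodMorphism.Build V VZ degree0 degree0_additive.

Lemma isD_degree0 (e : ell1 R V) : isD deg (push degree0 e) 0.
Proof.
move=> [v n]; change (0 = n%:~R * push degree0 e (v, n) :> R); have [->|n0] := eqVneq n 0; first by rewrite mul0r.
rewrite [push _ _ _](_ : _ = 0) ?mulr0//.
rewrite -[LHS]us_ind (us_push _ e (bd1 R _)) -[RHS](@us0 R V); apply: eq_us => u.
by rewrite /degree0 xpair_eqE eq_sym [0 == n]eq_sym (negPf n0) andbF mulr0.
Qed.

Lemma isD_deg_eq0 (Q : ell1 R VZ) w : isD deg Q 0 -> w.2 != 0 -> Q w = 0.
Proof.
move=> DQ w0; have /esym/eqP := DQ w.
by rewrite coef0 mulf_eq0 /deg intr_eq0 (negPf w0) => /eqP.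
Qed.

Definition fst0 (w : VZ) : V := w.1.
Fact fst0_additive : zmod_morphism fst0.
Proof. by []. Qed.
HB.instance Definition _ := GRing.isZmodMorphism.Build VZ V fst0 fst0_additive.

(* With [x] the element [e] put in degree 1 and [L] the logarithmic series in
   [x], the degree derivation kills [Q := (1 + x) exp (- L)], and [Q - 1] lives
   in positive degree; hence [Q = 1]. *)
Lemma ell1_log (e : ell1 R V) r : r < 1 -> (forall t, normc (ev phi t e) <= r) ->
  exists l : ell1 R V, forall t, cexp (ev phi t l) = 1 + ev phi t e.
Proof.
move=> r1 er.
have r0 : 0 <= r by apply: le_trans (er 0); exact: normc_ge0.
pose x := push degree0 e * delta R ((0, 1) : VZ).
(* Moving [e] to degree 1 does not increase the norms of powers, so [x] inherits the growth rate
   given by the transform of [e]. *)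
have nrmx n : nrm (x ^+ n) <= nrm (e ^+ n).
  rewrite exprMn -rmorphXn; apply: le_trans (nrmM _ _) _.
  rewrite -[leRHS]mulr1; apply: ler_pM; rewrite ?nrm_ge0 ?nrm_push//.
  by apply: le_trans (nrmX _ _) _; rewrite nrm_delta expr1n.
have okx (c : nat -> R) : (forall n, `|c n| <= 1) -> psA_ok c x.
  move=> c1; apply: psA_ok_le nrmx _.
  by apply: (psA_ok_spectral phi_inj r1 er (d := 0)) => n; rewrite expr0.
have Dx : isD deg x x.
  apply: isD_eq (isD_mul (isD_degree0 e) (isD_delta _ _)) _.
  by rewrite mul0r add0r /deg /= rmorph1 mul1r.
have px : posdeg x.
  move=> w w0; rewrite /x mulrC coefM_delta.
  have /eqP : (w.2 - 1)%:~R * push degree0 e (w - (0, 1)) = 0 :> R.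
    exact: esym (isD_degree0 e (w - (0, 1))).
  rewrite mulf_eq0 intr_eq0 subr_eq0 => /orP[/eqP w1|/eqP//].
  by rewrite w1 in w0.
(* The coefficients of [log (1 + x)]. Since the inverse of 0 is 0, [c 0] vanishes and [L] has no
   constant term. *)
pose c n : R := (-1) ^+ n.+1 / n%:R.
have c1 n : `|c n| <= 1.
  rewrite /c normrM normrX normrN1 expr1n mul1r normfV normr_nat.
  by case: n => [|n]; rewrite ?invr0// invf_le1 ?ler1n ?ltr0n.
have cS n : n.+1%:R * c n.+1 = (-1) ^+ n.
  by rewrite /c mulrCA divff ?mulr1 ?pnatr_eq0// exprSr exprSr -mulrA mulrNN !mulr1.
have okL : psA_ok c x by exact: okx.
have okg : psA_ok (fun n => n.+1%:R * c n.+1) x.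
  by apply: okx => n; rewrite cS normrX normrN1 expr1n.
pose L := psA c x; pose g := psA (fun n => n.+1%:R * c n.+1) x.
have DL : isD deg L (g * x) := isD_psA Dx okL okg.
have xN n : (- x) ^+ n = cst VZ ((-1) ^+ n) * x ^+ n.
  by rewrite rmorphXn rmorphN !rmorph1 -exprNn.
(* The derived series is the geometric series in [- x], so that [L] has derivative [x / (1 + x)]. *)
have gx : (1 + x) * g = 1.
  have -> : g = psA (fun=> 1) (- x).
    by congr asum; apply/funext => n; rewrite cS xN rmorph1 mul1r.
  rewrite -[X in 1 + X]opprK; apply: neumann.
  apply: eq_sm (okx (fun=> 1) _) => n; last by rewrite normr1.
  by rewrite xN nrmZ normrX normrN1 expr1n !mul1r.
have pL : posdeg L.
  have := posdeg_psA okL px; by rewrite /c invr0 mulr0 rmorph0 subr0.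
pose E := expA (- L).
have DE : isD deg E (E * - (g * x)).
  have := isD_psA (isD_opp DL) (expA_ok (- L)).
  have cE n : n.+1%:R * (n.+1`!%:R)^-1 = (n`!%:R)^-1 :> R.
    rewrite factS natrM invfM mulrA divff ?mul1r// pnatr_eq0//.
  by rewrite (funext cE); apply; exact: expA_ok.
have pE : posdeg (E - 1).
  have := posdeg_psA (expA_ok (- L)).
  rewrite fact0 invr1 rmorph1; apply => w w0; by rewrite coefN pL// oppr0.
have DQ : isD deg ((1 + x) * E) 0.
  apply: isD_eq (isD_mul (isD_add (isD1 _) Dx) DE) _.
  rewrite add0r (_ : _ + _ = x * E - (1 + x) * g * (x * E)); last by ring.
  by rewrite gx mul1r subrr.
have QE : (1 + x) * E = 1.
  apply: ell1P => w; have [w0|w0] := lerP w.2 0; last first.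
    rewrite (isD_deg_eq0 DQ) ?gt_eqF//=; case: eqP => [w00|//].
    by rewrite w00 /= ltxx in w0.
  have -> : (1 + x) * E = 1 + (x + (E - 1) + x * (E - 1)) by ring.
  move: (E - 1) pE => y py; by rewrite !coefD px// py// (posdegM px py)// !addr0.
(* Forgetting the degree turns [delta R (0, 1)] into 1, hence the transform of [x] into that of
   [e]. *)
exists (push fst0 L) => t.
pose phi' : {additive VZ -> R} := phi \o fst0.
have evx : ev phi' t x = ev phi t e.
  rewrite evM ev_push ev_delta [phi' _]raddf0 mulr0 cexp0 mulr1; congr ev.
have := ev_log phi' t QE; rewrite evx => ->; congr cexp; exact: ev_push.
Qed.

End logarithm.

(** * Trigonometric polynomials without zeros *)

Section winding.
Variables (R : realType) (W : zmodType) (I : finType).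
Variables (phi : {additive W -> R}) (psi : I -> {additive W -> R}).
Hypothesis psi_ge1 : forall i w, psi i w != 0 -> 1 <= `|psi i w|.
Hypothesis psi_inj : forall w, (forall i, psi i w = 0) -> w = 0.
Implicit Types (a b : ell1 R W).

Lemma isD_uniq (p : W -> R) a a' a'' : isD p a a' -> isD p a a'' -> a' = a''.
Proof. by move=> Da Db; apply: ell1P => w; rewrite Da Db. Qed.

Lemma isD_expA (p : {additive W -> R}) a a' :
  isD p a a' -> isD p (expA a) (expA a * a').
Proof.
move=> Da; have := isD_psA Da (expA_ok a).
have cE n : n.+1%:R * (n.+1`!%:R)^-1 = (n`!%:R)^-1 :> R.
  by rewrite factS natrM invfM mulrA divff ?mul1r// pnatr_eq0.
by rewrite (funext cE); apply; exact: expA_ok.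
Qed.

Lemma sm_sum (J : Type) (T : choiceType) (s : seq J) (F : J -> T -> R) :
  (forall j, sm (F j)) -> sm (fun x => \sum_(j <- s) F j x).
Proof.
move=> sF; elim: s => [|j s IH].
  by apply: eq_sm (sm0 R T) => x; rewrite big_nil.
by apply: eq_sm (smD (sF j) IH) => x; rewrite big_cons.
Qed.

Section primitive.
Variable c : I -> ell1 R W.
Hypothesis c_closed : forall i j w, psi j w * c i w = psi i w * c j w.

(** By [c_closed] the quotient is the same for every admissible [i], and by [psi_ge1] it is at most
    [|c i w|]. The [pick] fails only at [w = 0], by [psi_inj]. *)
Let prim w := if [pick i | psi i w != 0] is Some i then c i w / psi i w else 0.

Let sm_prim : sm prim.
Proof.
apply: (@sm_le _ _ _ (fun w => \sum_(i <- enum I) `|c i w|)); last first.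
  by apply: sm_sum => i; exact/sm_abs/coef_sm.
move=> w; rewrite /prim big_enum /=; case: pickP => [i iw|_]; last first.
  by rewrite normr0 sumr_ge0.
rewrite (bigD1 i)//= -[leLHS]addr0; apply: lerD; last by rewrite sumr_ge0.
by rewrite normrM normfV ler_pdivrMr ?normr_gt0// ler_peMr// psi_ge1.
Qed.

Lemma exists_primitive : exists h : ell1 R W, forall i, isD (psi i) h (c i - cst W (c i 0)).
Proof.
exists (Ell1 sm_prim) => i w; rewrite coefD coefN /= /prim.
case: (eqVneq w 0) => [->|w0].
  by rewrite mul1r subrr raddf0 mul0r.
rewrite mul0r subr0; case: pickP => [j jw|H].
  by rewrite mulrA -(c_closed i j) mulrAC divff// mul1r.
by case/negP: w0; apply/eqP/psi_inj => j; apply/eqP; have := H j; case: eqP.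
Qed.

End primitive.

(** On [Z^d] with its coordinates, the mean [g i] of [D_i P / P] is the winding number of [P] around
    the [i]-th circle of the torus. Its integrality is a by-product: it is the coordinate [psi i m]
    of the surviving point. *)
Lemma winding (P b : ell1 R W) (P1 : I -> ell1 R W) : P * b = 1 ->
  (forall i, isD (psi i) P (P1 i)) ->
  (forall i j, exists P2, isD (psi j) (P1 i) P2) ->
  (forall i, exists b', isD (psi i) b b') ->
  exists q m (h : ell1 R W), forall t,
    ev phi t P = q%:C * cexp (0 +i* (t * phi m)) * cexp (ev phi t h).
Proof.
move=> Pb DP DP1 Db.
(* Some derivative of [b] exists by hypothesis; differentiating [P * b = 1] identifies it as
   [- P1 i / P ^+ 2]. *)
have Db1 i : isD (psi i) b (- (b * b * P1 i)).
  have [b' Db'] := Db i; apply: (isD_eq Db').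
  have H : P1 i * b + P * b' = 0.
    by apply: isD_uniq (isD_mul (DP i) Db') _; rewrite Pb; exact: isD1.
  have E : b' = b * (P1 i * b + P * b') - b * b * P1 i + (1 - P * b) * b' by ring.
  by rewrite E H Pb subrr mul0r mulr0 addr0 add0r.
(* The second derivatives of [P] are symmetric in [i] and [j], and so are those of its logarithm. *)
have closed i j w : psi j w * (P1 i * b) w = psi i w * (P1 j * b) w.
  have [Pij DPij] := DP1 i j.
  have DPji : isD (psi i) (P1 j) Pij.
    by move=> v; rewrite DPij !(DP _ v); ring.
  rewrite -(isD_mul DPij (Db1 j) w) -(isD_mul DPji (Db1 i) w).
  by congr (coef _ w); ring.
have [h Dh] := exists_primitive closed.
pose g i := (P1 i * b) 0.
pose Q := P * expA (- h).
have DQ i : isD (psi i) Q (cst W (g i) * Q).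
  apply: isD_eq (isD_mul (DP i) (isD_expA (isD_opp (Dh i)))) _.
  rewrite /Q -/(g i); move: (expA _) (cst W (g i)) => E G.
  rewrite (_ : _ + _ = (1 - P * b) * P1 i * E + G * (P * E)); last by ring.
  by rewrite Pb subrr !mul0r add0r.
have evQ t : ev phi t Q * cexp (ev phi t h) = ev phi t P.
  by rewrite evM ev_expA evN -mulrA -cexpD addNr cexp0 mulr1.
have [m Qm] : exists m, Q m != 0.
  apply: contrapT => Q0; have Qz : Q = 0.
    by apply: ell1P => w; apply/eqP; apply: contra_notT Q0 => Qw; exists w.
  have := congr1 (ev phi 0) Pb; rewrite evM -evQ Qz ev1 (_ : ev phi 0 0 = 0); last exact: raddf0.
  by rewrite !mul0r => /eqP; rewrite eq_sym oner_eq0.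
(* On the support of [Q] every coordinate equals the constant [g i], so by [psi_inj] the support is
   a single point. *)
have psiQ i w : Q w != 0 -> psi i w = g i.
  by move=> Qw; have := DQ i w; rewrite coefZ => /(mulIf Qw).
have QE : Q = cst W (Q m) * delta R m.
  apply: ell1P => w; rewrite coefZ /=; case: eqVneq => [->|wm]; first by rewrite mulr1.
  rewrite mulr0; apply/eqP; apply: contraNT wm => Qw; rewrite -subr_eq0; apply/eqP/psi_inj => i.
  by rewrite raddfB !psiQ// subrr.
exists (Q m), m, h => t; rewrite -evQ {1}QE.
by rewrite evM ev_cst ev_delta.
Qed.

End winding.

(** * Finitely generated subgroups of a torsion-free group *)

Section lattice.
Variables (V : zmodType).
Hypothesis torsion_free : forall (v : V) (n : int), v *~ n = 0 -> n != 0 -> v = 0.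

Definition latt d (b : 'I_d -> V) (m : 'rV[int]_d) : V := \sum_j b j *~ m 0 j.

Fact latt_additive d (b : 'I_d -> V) : zmod_morphism (latt b).
Proof.
by move=> m n; rewrite /latt -sumrB; apply: eq_bigr => j _; rewrite !mxE mulrzBr.
Qed.
HB.instance Definition _ d (b : 'I_d -> V) :=
  GRing.isZmodMorphism.Build 'rV[int]_d V (latt b) (latt_additive b).

Definition spanned d (b : 'I_d -> V) v := exists m, v = latt b m.

Lemma spannedD d (b : 'I_d -> V) v w : spanned b v -> spanned b w -> spanned b (v + w).
Proof. by move=> [m ->] [n ->]; exists (m + n); rewrite raddfD. Qed.

Lemma spannedZ d (b : 'I_d -> V) v n : spanned b v -> spanned b (v *~ n).
Proof. by move=> [m ->]; exists (m *~ n); rewrite raddfMz. Qed.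

(** The independent family [b] takes its values in [V], so that whatever is computed on the lattice
    returns to [V] through [latt b]. *)
Let has_basis n (x : 'I_n -> V) := exists d (b : 'I_d -> V),
  injective (latt b) /\ forall i, spanned b (x i).

(* Euclid's algorithm on a nontrivial relation between the generators. *)
Let basis_of_relation n (x : 'I_n.+1 -> V) (c : 'rV[int]_n.+1) :
  (forall y : 'I_n -> V, has_basis y) -> latt x c = 0 -> c != 0 -> has_basis x.
Proof.
move=> IH; move: {2}(\sum_i (absz (c 0%R i)))%N (leqnn (\sum_i (absz (c 0%R i)))) => K.
elim: K x c => [|K IHK] x c.
  rewrite leqn0 sum_nat_eq0 => /forallP c0 _ /negP[]; apply/eqP/rowP => j.
  by have := c0 j; rewrite mxE absz_eq0 => /eqP.
move=> cK xc c0.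
have step i j : i != j -> c 0 i != 0 -> c 0 j != 0 -> (absz (c 0%R j) <= absz (c 0%R i))%N -> has_basis x.
  move=> ij ci cj cij.
  (* The sign [s] makes [|c i - s c j| = |c i| - |c j|], a strict decrease; adding [s x i] to the
     generator [x j] keeps the relation true. *)
  pose s : int := sgz (c 0 i * c 0 j).
  pose c' : 'rV[int]_n.+1 := \row_k (if k == i then c 0 i - s * c 0 j else c 0 k).
  pose x' k := if k == j then x j + x i *~ s else x k.
  have [||| d [b [binj bx]]] := IHK x' c'.
  - rewrite -ltnS; apply: leq_trans cK.
    rewrite (bigD1 i)//= [ltnRHS](bigD1 i)//=.
    rewrite [X in (_ + X < _)%N](eq_bigr (fun k => (absz (c 0%R k)))); last first.
      by move=> k /negPf ki; rewrite mxE ki.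
    rewrite ltn_add2r mxE eqxx /s; move: ci cj cij; clear.
    by case: (sgzP (c 0 i * c 0 j)); nia.
  - rewrite -[RHS]xc /latt (bigD1 i)// (bigD1 j) 1?eq_sym//=.
    rewrite [in RHS](bigD1 i)// [in RHS](bigD1 j) 1?eq_sym//=.
    rewrite !addrA; congr (_ + _); last first.
      by apply: eq_bigr => k /andP[/negPf ki /negPf kj]; rewrite mxE ki /x' kj.
    rewrite !mxE /x' eqxx (negPf ij) eq_sym (negPf ij) eqxx.
    by rewrite mulrzBr mulrzDl -[x i *~ s *~ _]mulrzA [x j *~ _ + _]addrC addrA subrK.
  - apply: contraNneq cj => /rowP/(_ j); rewrite !mxE eq_sym (negPf ij) => ->//.
  exists d, b; split=> // k; have := bx k; rewrite /x'; case: eqP => [->|//] H.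
  have -> : x j = (x j + x i *~ s) + x i *~ (- s) by rewrite mulrNz addrK.
  apply: spannedD => //; apply: spannedZ.
  by have := bx i; rewrite /x' (negPf ij).
have [i ci] : exists i, c 0 i != 0.
  by apply/existsP; apply: contraNT c0; rewrite negb_exists => /forallP c0;
     apply/eqP/rowP => k; have := c0 k; rewrite negbK mxE => /eqP.
have [[j [ji cj]]|H] := pselect (exists j, j != i /\ c 0 j != 0).
  case: (leqP (absz (c 0%R j)) (absz (c 0%R i))) => [cij|/ltnW cij]; last exact: step cij.
  by apply: (step i j) => //; rewrite eq_sym.
(* The relation has shrunk to [c i x i = 0], so torsion-freeness removes a generator and the
   induction hypothesis on [n] applies. *)
have xi : x i = 0.
  apply: (torsion_free (n := c 0 i)) => //; rewrite -[RHS]xc /latt (bigD1 i)//= big1 ?addr0// => j ji.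
  have -> : c 0 j = 0 by apply/eqP; apply: contra_notT H => cj; exists j.
  by rewrite mulr0z.
have [d [b [binj bx]]] := IH (fun k => x (lift i k)).
exists d, b; split=> // k; case: (unliftP i k) => [k' ->|->]; first exact: bx.
by exists 0; rewrite raddf0.
Qed.

Lemma lattice_basis n (x : 'I_n -> V) : exists d (b : 'I_d -> V),
  injective (latt b) /\ forall i, spanned b (x i).
Proof.
elim: n x => [|n IH] x.
  exists 0%N, x; split=> [m m' _|[]//]; by apply/rowP => -[].
have [xinj|/existsNP[m /existsNP[m' /not_implyP[E mm']]]] := pselect (injective (latt x)).
  exists n.+1, x; split=> // i; exists (delta_mx 0 i).
  rewrite /latt (bigD1 i)//= big1 => [|j ji]; first by rewrite mxE !eqxx addr0.
  by rewrite mxE eqxx (negPf ji).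
apply: (@basis_of_relation n x (m - m')) => //.
  by rewrite raddfB; apply/eqP; rewrite subr_eq0; apply/eqP; exact: E.
by rewrite subr_eq0; apply/eqP.
Qed.

End lattice.

Section integer_coordinates.
Variables (R : realType) (d : nat).

Definition coord_mx (j : 'I_d) (m : 'rV[int]_d) : R := (m 0 j)%:~R.
Fact coord_mx_additive j : zmod_morphism (coord_mx j).
Proof. by move=> m n; rewrite /coord_mx !mxE rmorphB. Qed.
HB.instance Definition _ j :=
  GRing.isZmodMorphism.Build 'rV[int]_d R (coord_mx j) (coord_mx_additive j).

Lemma coord_mx_ge1 j m : coord_mx j m != 0 -> 1 <= `|coord_mx j m|.
Proof.
rewrite /coord_mx intr_eq0 => mj; rewrite -intr_norm ler1z; move: mj; lia.
Qed.

Lemma coord_mx_inj m : (forall j, coord_mx j m = 0) -> m = 0.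
Proof.
move=> H; apply/rowP => j; rewrite mxE; apply/eqP.
by have /eqP := H j; rewrite /coord_mx intr_eq0.
Qed.

End integer_coordinates.

(** * Factorisation into a constant, a character and an exponential *)

Section quasi_infinitely_divisible.
Variables (R : realType) (V : zmodType) (phi : {additive V -> R}).
Hypothesis phi_inj : injective phi.
Local Notation normc := (@ComplexField.Normc.normc R).

Lemma torsion_free_inj (v : V) (n : int) : v *~ n = 0 -> n != 0 -> v = 0.
Proof.
move=> /(congr1 phi); rewrite raddfMz raddf0 => /eqP; rewrite -mulrzr mulf_eq0 intr_eq0.
by case/orP => [/eqP vn _|->//]; apply: phi_inj; rewrite raddf0.
Qed.

Lemma trig_poly_factor (J : {fset V}) (P : ell1 R V) mu :
  (forall v, v \notin J -> P v = 0) -> 0 < mu ->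
  (forall t, mu <= normc (ev phi t P)) ->
  exists q m (h : ell1 R V), forall t,
    ev phi t P = q%:C * cexp (0 +i* (t * phi m)) * cexp (ev phi t h).
Proof.
move=> PJ mu0 Pmu.
have [d [b [binj bJ]]] := lattice_basis torsion_free_inj (fun i : 'I_#|` J| => nth 0 J i).
have coordJ v : exists m, v \in J -> v = latt b m.
  have [vJ|] := boolP (v \in J); last by exists 0.
  have iJ : (index v J < #|` J|)%N by rewrite index_mem.
  by have [m Em] := bJ (Ordinal iJ); exists m => _; rewrite -Em /= nth_index.
pose m v := projT1 (cid (coordJ v)).
have mE v : v \in J -> v = latt b (m v) by rewrite /m; case: cid.
(* A lift of [P] to the lattice. Its transform at [phi \o latt b] is that of [P], so the lower bound
   persists, and this composite is still injective as [ell1_inverse] demands. *)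
pose P' : ell1 R 'rV[int]_d := \sum_(v <- J) cst _ (P v) * delta R (m v).
have PP' : P = push (latt b) P'.
  rewrite /P' raddf_sum; apply: ell1P => v.
  rewrite (_ : P v = trunc J P v); last by rewrite coef_trunc; case: ifP => // /negbT/PJ.
  congr (coef _ v); rewrite /trunc big_seq [RHS]big_seq; apply: eq_bigr => u uJ.
  transitivity (push (latt b) (cst 'rV[int]_d (P u) * delta R (m u))); last by [].
  by rewrite pushM push_cst push_delta; congr (_ * delta R _); exact: mE.
pose phi' : {additive 'rV[int]_d -> R} := phi \o latt b.
have phi'_inj : injective phi' by apply: inj_comp.
have evP t : ev phi t P = ev phi' t P' by rewrite PP' ev_push.
have P'mu t : mu <= normc (ev phi' t P') by rewrite -evP.
have [g P'g Dg] := ell1_inverse phi'_inj mu0 P'mu.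
(* Stated for arbitrary coefficients so that it also differentiates the derivatives. *)
have isD_sum (j : 'I_d) (c : V -> R) :
    isD (coord_mx R j) (\sum_(v <- J) cst _ (c v) * delta R (m v))
      (\sum_(v <- J) cst _ (coord_mx R j (m v) * c v) * delta R (m v)).
  move=> w; rewrite !coef_sum mulr_sumr; apply: eq_bigr => v _.
  by rewrite !coefZ /=; case: eqVneq => [->|_]; rewrite ?mulr1 ?mulr0.
have [q [n [h Hh]]] := @winding _ _ _ phi' (fun j => coord_mx R j) (@coord_mx_ge1 R d)
  (@coord_mx_inj R d) P' g _ P'g (fun j => isD_sum j _)
  (fun i j => ex_intro _ _ (isD_sum j _)) (fun i => Dg _ _ (isD_sum i _)).
by exists q, (latt b n), (push (latt b) h) => t; rewrite evP Hh ev_push.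
Qed.

Lemma ell1_factor (f : ell1 R V) mu : 0 < mu -> (forall t, mu <= normc (ev phi t f)) ->
  exists q m (h : ell1 R V), forall t,
    ev phi t f = q%:C * cexp (0 +i* (t * phi m)) * cexp (ev phi t h).
Proof.
(* Within [mu / 8] in norm, the transforms differ by at most [mu / 4], so that of [P] keeps modulus
   at least [3 mu / 4]. *)
move=> mu0 fmu; have [|J HJ] := @trunc_approx _ _ f (mu / 8); first by rewrite divr_gt0.
set P := trunc J f in HJ; pose D := f - P.
have normD t : normc (ev phi t D) <= mu / 4.
  apply: le_trans (normc_ev _ _ _) _; rewrite (_ : mu / 4 = 2 * (mu / 8)); last by field.
  by rewrite ler_wpM2l.
have fE : f = P + D by rewrite /D addrC subrK.
have Pmu t : mu * (3 / 4) <= normc (ev phi t P).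
  have := fmu t; rewrite fE evD => H.
  have := le_trans H (le_normcD _ _); have := normD t; lra.
have PJ v : v \notin J -> P v = 0 by move=> /negPf vJ; rewrite coef_trunc vJ.
have mu1 : 0 < mu * (3 / 4) by rewrite mulr_gt0// divr_gt0.
have [q [m [h Hh]]] := trig_poly_factor PJ mu1 Pmu.
have [b Pb _] := ell1_inverse phi_inj mu1 Pmu.
(* Here [f = P * (1 + D * b)], and the modulus of [D / P] is at most
   [(mu / 4) / (3 mu / 4) = 1 / 3]. *)
have er t : normc (ev phi t (D * b)) <= 1 / 2.
  rewrite evM ComplexField.Normc.normcM.
  have : normc (ev phi t P) * normc (ev phi t b) = 1.
    by rewrite -ComplexField.Normc.normcM -evM Pb ev1 ComplexField.Normc.normc1.
  have := normD t; have := Pmu t; have := normc_ge0 (ev phi t D); have := normc_ge0 (ev phi t b).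
  move: (normc (ev phi t D)) (normc (ev phi t P)) (normc (ev phi t b)) => x y z; nra.
have [|l Hl] := ell1_log phi_inj _ er; first by lra.
exists q, m, (h + l) => t.
rewrite evD cexpD mulrA -Hh Hl -(ev1 phi t) -evD -evM mulrDr mulr1.
by rewrite mulrCA Pb mulr1 -fE.
Qed.

End quasi_infinitely_divisible.

(** * Frequencies in the group generated by a set *)

Section zspan_group.
Variables (R : realType) (X : set R).

Lemma zspan_mem x : X x -> zspan X x.
Proof.
move=> Xx; exists 1%N, (fun=> 1), (fun=> x); split=> //.
by rewrite big_ord1 rmorph1 mul1r.
Qed.

Lemma zspan0 : X !=set0 -> zspan X 0.
Proof.
move=> [x Xx]; exists 1%N, (fun=> 0), (fun=> x); split=> //.
by rewrite big_ord1 rmorph0 mul0r.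
Qed.

Lemma zspanB u v : zspan X u -> zspan X v -> zspan X (u - v).
Proof.
move=> [m [c [y [m0 Xy ->]]]] [n [c' [y' [n0 Xy' ->]]]].
exists (m + n)%N, (fun k => match fintype.split k with inl i => c i | inr j => - c' j end),
  (fun k => match fintype.split k with inl i => y i | inr j => y' j end); split.
- by rewrite addn_gt0 m0.
- by move=> k; case: (fintype.split k).
rewrite big_split_ord /= -sumrN; congr (_ + _); apply: eq_bigr => i _.
  by rewrite (unsplitK (inl i)).
by rewrite (unsplitK (inr i)) rmorphN mulNr.
Qed.

Variable X0 : X !=set0.

(** Combinations in [zspan] have at least one term, so 0 belongs to the span only through an element
    of [X]. Carrying the proof as an argument lets the closure instance be attached to the
    predicate. *)
Definition zspan_pred of X !=set0 : {pred R} := fun u => `[< zspan X u >].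

Fact zspan_zmod_closed : zmod_closed (zspan_pred X0).
Proof.
split; first by apply/asboolP/zspan0.
by move=> u v /asboolP Hu /asboolP Hv; apply/asboolP/zspanB.
Qed.
HB.instance Definition _ := GRing.isZmodClosed.Build R (zspan_pred X0) zspan_zmod_closed.

Record zspan_group := ZspanGroup { zspan_val : R; _ : zspan_val \in zspan_pred X0 }.
HB.instance Definition _ := [isSub for zspan_val].
HB.instance Definition _ := [Choice of zspan_group by <:].
HB.instance Definition _ := [SubChoice_isSubZmodule of zspan_group by <:].

Fact zspan_val_additive : zmod_morphism zspan_val.
Proof. by move=> u v; exact: (raddfB (val : zspan_group -> R)). Qed.
HB.instance Definition _ := GRing.isZmodMorphism.Build zspan_group R zspan_val zspan_val_additive.

Lemma zspan_valP (u : zspan_group) : zspan X (zspan_val u).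
Proof. by case: u => u /= /asboolP. Qed.

Lemma zspan_valK u : zspan X u -> zspan_val (insubd (0 : zspan_group) u) = u.
Proof. by move=> Hu; apply: (@insubdK R (zspan_pred X0)); apply/asboolP. Qed.

Lemma zspan_val_inj : injective zspan_val.
Proof. exact: val_inj. Qed.

End zspan_group.

(** * Complex unordered sums and removal of indices with zero terms *)

Section complex_sums.
Variable R : realType.

Lemma cvg_Re (u : nat -> R[i]) (l : R[i]) : u @ \oo --> l ->
  (fun n => complex.Re (u n)) @ \oo --> complex.Re l.
Proof.
move=> /cvgrPdist_lt H; apply/cvgrPdist_lt => e e0.
have /H : 0 < e%:C :> R[i] by rewrite ltcR.
apply: filterS => n; rewrite normcE ltcR; apply: le_lt_trans.
by have := Re_le_normc (l - u n); rewrite raddfB.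
Qed.

Lemma cvg_Im (u : nat -> R[i]) (l : R[i]) : u @ \oo --> l ->
  (fun n => complex.Im (u n)) @ \oo --> complex.Im l.
Proof.
move=> /cvgrPdist_lt H; apply/cvgrPdist_lt => e e0.
have /H : 0 < e%:C :> R[i] by rewrite ltcR.
apply: filterS => n; rewrite normcE ltcR; apply: le_lt_trans.
by have := Im_le_normc (l - u n); rewrite raddfB.
Qed.

Lemma complex_sumE (T : choiceType) (F : T -> R[i]) :
  sm (fun i => complex.Re (F i)) -> sm (fun i => complex.Im (F i)) ->
  summability.sum F = us (fun i => complex.Re (F i)) +i* us (fun i => complex.Im (F i)).
Proof.
move=> sR sI; apply: cvg_lim; first exact: norm_hausdorff.
(* In the order of [R[i]] a positive [e] is real, so it can be replaced by its real part. *)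
apply/cvgrPdist_lt => e; rewrite ltcE /= => /andP[/eqP e_real e0].
have eE : e = (complex.Re e)%:C by case: e e_real {e0} => a b /= ->.
rewrite eE; move: (complex.Re e) e0 => r r0 {e e_real eE}.
have r20 : 0 < r / 2 by rewrite divr_gt0.
have /cvgrPdist_lt /(_ _ r20) HR := us_cvg sR.
have /cvgrPdist_lt /(_ _ r20) HI := us_cvg sI.
near=> J; rewrite normcE ltcR; apply: le_lt_trans (normc_le _) _.
have -> : r = r / 2 + r / 2 by field.
have hR : complex.Re (summability.partial_sum F J) = summability.partial_sum (fun i => complex.Re (F i)) J.
  by rewrite /summability.partial_sum; apply: (big_morph (@complex.Re R)) => // -[a b] [a' b'].
have hI : complex.Im (summability.partial_sum F J) = summability.partial_sum (fun i => complex.Im (F i)) J.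
  by rewrite /summability.partial_sum; apply: (big_morph (@complex.Im R)) => // -[a b] [a' b'].
apply: ltrD.
  rewrite [complex.Re _]raddfB /= hR; near: J; exact: HR.
rewrite [complex.Im _]raddfB /= hI; near: J; exact: HI.
Unshelve. all: by end_near. Qed.

(** Spread [g] over the graph of [e] and sum in both orders. It serves for the inclusion of the
    nonzero elements of the span, whose image misses 0. *)
Lemma us_reindex_supp (S T : choiceType) (e : S -> T) (g : T -> R) : injective e ->
  (forall v, g v != 0 -> exists s, e s = v) -> sm g -> us (fun s => g (e s)) = us g.
Proof.
move=> einj esupp sg.
have sF : sm (fun x : T * S => (e x.2 == x.1)%:R * g x.1).
  apply: sm_pair => [v|].
    have [[s es]|H] := pselect (exists s, e s = v).
      apply: (@sm1 _ _ s) => s' /negPf s's; rewrite /= -es (inj_eq einj) s's mul0r//.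
    apply: eq_sm (sm0 R S) => s /=; case: eqP => [es|_]; last by rewrite mul0r.
    by case: H; exists s.
  apply: (@sm_le _ _ _ (fun v => `|g v|)); last exact: sm_abs.
  move=> v /=; have [[s es]|H] := pselect (exists s, e s = v).
    rewrite (@us1 _ _ s) => [|s' /negPf s's]; first by rewrite es eqxx mul1r normr_id.
    by rewrite -es (inj_eq einj) s's mul0r normr0.
  rewrite (_ : us _ = 0) ?normr0// -[RHS](@us0 R S); apply: eq_us => s.
  by case: eqP => [es|_]; rewrite ?mul0r ?normr0//; case: H; exists s.
have := us_swap sF => /= H.
transitivity (us (fun s => us (fun v => (e s == v)%:R * g v))).
  apply: eq_us => s; rewrite (@us1 _ _ (e s)) ?eqxx ?mul1r// => v.
  by rewrite eq_sym => /negPf->; rewrite mul0r.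
rewrite -H; apply: eq_us => v; have [gv|gv] := eqVneq (g v) 0.
  by rewrite gv -[RHS](@us0 R S); apply: eq_us => s; rewrite mulr0.
have [s es] := esupp _ gv.
rewrite (@us1 _ _ s) => [|s' /negPf s's]; first by rewrite es eqxx mul1r.
by rewrite -es (inj_eq einj) s's mul0r.
Qed.

End complex_sums.

Theorem theorem2 (R : realType) (x : nat -> R) (p : R -> R) (F : R -> R)
    (f : R -> R[i]) (X : set R) (mu : R)
    (x_inj : injective x)
    (p_ge0 : forall k, 0 <= p (x k))
    (p_sum1 : series (fun k => p (x k)) @ \oo --> (1 : R))
    (F_def : forall y : R,
      series (fun k => p (x k) * unit_step (x k) y) @ \oo --> F y)
    (X_def : X = [set y | exists2 k, y = x k & 0 < p (x k)])
    (f_def : forall t : R,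
      series (fun k => (p (x k))%:C * cexp (0 +i* (t * x k))) @ \oo --> f t)
    (mu_gt0 : 0 < mu)
    (f_ge : forall t : R, mu%:C <= `|f t|) :
  exists (gamma : R) (lambda : set_type (zspan X `\ 0) -> R),
    [/\ zspan X gamma,
        summable [set: set_type (zspan X `\ 0)] (fun u => (lambda u)%:E) &
        forall t : R,
          f t = cexp (0 +i* (t * gamma) +
            summability.sum (fun u : set_type (zspan X `\ 0) =>
              (lambda u)%:C * (cexp (0 +i* (t * set_val u)) - 1)))].
Proof.
have X0 : X !=set0.
  apply: contrapT => XE.
  have px0 k : p (x k) = 0.
    apply/eqP; rewrite eq_le p_ge0 andbT leNgt; apply/negP => pk.
    by apply: XE; exists (x k); rewrite X_def; exists k.
  have s0 : series (fun k => p (x k)) = (fun=> 0).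
    by apply/funext => n; rewrite /series /= big1// => k _; exact: px0.
  rewrite s0 in p_sum1; have : (1 : R) = 0.
    apply: (cvg_unique (@Rhausdorff R) p_sum1); exact: cvg_cst.
  by move/eqP; rewrite oner_eq0.
pose V : zmodType := zspan_group X0; pose phi : {additive V -> R} := @zspan_val R X X0.
have phi_inj : injective phi by exact: zspan_val_inj.
(* The default 0 can occur only where [x k] is outside the span; there [p (x k) = 0], and [G k]
   vanishes. *)
pose v k : V := insubd 0 (x k).
pose G k : ell1 R V := cst V (p (x k)) * delta R (v k).
have sp : sm (fun k => p (x k)).
  apply: sm_nat; apply/cvg_ex; exists 1.
  by rewrite (_ : (fun k => `|p (x k)|) = (fun k => p (x k)))//; apply/funext => k; rewrite ger0_norm.
have sG : sm (fun k => nrm (G k)).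
  by apply: eq_sm sp => k; rewrite nrmZ nrm_delta mulr1 ger0_norm.
have evG t k : ev phi t (G k) = (p (x k))%:C * cexp (0 +i* (t * x k)).
  rewrite evM ev_cst ev_delta; have [pk|pk] := ltrP 0 (p (x k)).
    have -> : phi (v k) = x k; last by [].
    by apply: zspan_valK; apply: zspan_mem; rewrite X_def; exists k.
  have -> : p (x k) = 0 by apply/eqP; rewrite eq_le pk p_ge0.
  by rewrite rmorph0 !mul0r.
have evf t : ev phi t (asum G) = f t.
  rewrite ev_asum// [RHS](_ : _ = complex.Re (f t) +i* complex.Im (f t)); last by case: (f t).
  congr Complex.
    apply: (cvg_unique (@Rhausdorff R) (us_nat (sm_ev_Re phi t sG))).
    rewrite (_ : series _ = (fun N => complex.Re (series (fun k => (p (x k))%:C * cexp (0 +i* (t * x k))) N))).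
      exact/cvg_Re/f_def.
    apply/funext => N; pose g k := (p (x k))%:C * cexp (0 +i* (t * x k)).
    transitivity (series (fun k => complex.Re (g k)) N).
      by congr (series _ N); apply/funext => k; rewrite evG.
    rewrite -/g /series; symmetry; apply: (big_morph (@complex.Re R)) => // -[a b] [a' b'] //.
  apply: (cvg_unique (@Rhausdorff R) (us_nat (sm_ev_Im phi t sG))).
  rewrite (_ : series _ = (fun N => complex.Im (series (fun k => (p (x k))%:C * cexp (0 +i* (t * x k))) N))).
    exact/cvg_Im/f_def.
  apply/funext => N; pose g k := (p (x k))%:C * cexp (0 +i* (t * x k)).
  transitivity (series (fun k => complex.Im (g k)) N).
    by congr (series _ N); apply/funext => k; rewrite evG.
  rewrite -/g /series; symmetry; apply: (big_morph (@complex.Im R)) => // -[a b] [a' b'] //.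
have fmu t : mu <= ComplexField.Normc.normc (ev phi t (asum G)).
  by rewrite evf -lecR -normcE.
have [q [m [h Hh]]] := ell1_factor phi_inj mu_gt0 fmu.
have f0 : f 0 = 1.
  have f0_def := f_def 0.
  rewrite (_ : f 0 = complex.Re (f 0) +i* complex.Im (f 0)); last by case: (f 0).
  have cexp00 k : cexp (0 +i* (0 * x k)) = 1 by rewrite mul0r cexp0.
  have sE : series (fun k => (p (x k))%:C * cexp (0 +i* (0 * x k))) =
      (fun N => (series (fun k => p (x k)) N)%:C).
    by apply/funext => N; rewrite /series rmorph_sum; apply: eq_bigr => k _; rewrite cexp00 mulr1.
  rewrite sE in f0_def.
  rewrite -(cvg_unique (@Rhausdorff R) p_sum1 (cvg_Re f0_def)).
  by rewrite (cvg_unique (@Rhausdorff R) (cvg_Im f0_def) (cvg_cst 0)).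
have qE : q%:C * cexp (ev phi 0 h) = 1.
  by rewrite -f0 -evf Hh mul0r cexp0 mulr1.
(* The value at [t = 0] forces [q = cexp (- ev phi 0 h)]; this subtraction is the source of the
   [- 1] in each term of the representation. *)
have shift t : f t = cexp (0 +i* (t * phi m)) * cexp (ev phi t h - ev phi 0 h).
  have qC : q%:C = cexp (- ev phi 0 h).
    by rewrite -[LHS]mulr1 -cexp0 -(subrr (ev phi 0 h)) cexpD mulrA qE mul1r.
  by rewrite -evf Hh cexpD qC [X in X * _]mulrC -mulrA [X in _ * X]mulrC.
pose lam (u : set_type (zspan X `\ 0)) : R := h (insubd 0 (set_val u)).
pose e (u : set_type (zspan X `\ 0)) : V := insubd 0 (set_val u).
have eE u : phi (e u) = set_val u.
  by apply: zspan_valK; have := set_valP u; case.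
have einj : injective e.
  by move=> u u' /(congr1 phi); rewrite !eE => /val_inj.
have esurj w : w != 0 -> exists u, e u = w.
  move=> w0; have Hw : phi w \in zspan X `\ 0.
    apply/mem_set; split; first exact: zspan_valP.
    by move=> /= pw; move/eqP: w0; apply; apply: phi_inj; rewrite raddf0.
  exists (SigSub Hw); apply: phi_inj; rewrite eE//.
exists (phi m), lam; split.
- exact: zspan_valP.
- by apply: (@sm_inj R _ _ e h einj); exact: coef_sm.
move=> t; rewrite shift -cexpD; congr (cexp (_ + _)).
have bc : bd (fun w : V => cos (t * phi w) - 1).
  exists 2 => w; apply: le_trans (ler_normB _ _) _; rewrite normr1 mulr2n lerD2r; exact: cos_max.
have evh0 : ev phi 0 h = us (fun w => h w) +i* 0.
  rewrite /ev; congr Complex; first by apply: eq_us => w; rewrite mul0r cos0 mulr1.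
  by rewrite -[RHS](@us0 R V); apply: eq_us => w; rewrite mul0r sin0 mulr0.
have FRe u : complex.Re ((lam u)%:C * (cexp (0 +i* (t * set_val u)) - 1)) =
    h (e u) * (cos (t * phi (e u)) - 1).
  by rewrite eE /cexp expR0 /= mul0r subr0 mul1r.
have FIm u : complex.Im ((lam u)%:C * (cexp (0 +i* (t * set_val u)) - 1)) =
    h (e u) * sin (t * phi (e u)).
  by rewrite eE /cexp expR0 /= mul0r addr0 mul1r subr0.
have sR := sm_coef_bd h bc; have sI := sm_coef_bd h (bd_sin phi t).
rewrite complex_sumE; last 2 first.
- by apply: eq_sm (@sm_inj _ _ _ e _ einj sR) => u; rewrite FRe.
- by apply: eq_sm (@sm_inj _ _ _ e _ einj sI) => u; rewrite FIm.
rewrite (eq_us FRe) (eq_us FIm).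
(* The terms vanish at [w = 0], so the sum over nonzero frequencies equals the sum over all of [V],
   whatever [h 0] is. *)
rewrite (us_reindex_supp (g := fun w => h w * (cos (t * phi w) - 1)) einj _ sR); last first.
  by move=> w Hw; apply: esurj; apply: contraNneq Hw => ->; rewrite raddf0 mulr0 cos0 subrr mulr0.
rewrite (us_reindex_supp (g := fun w => h w * sin (t * phi w)) einj _ sI); last first.
  by move=> w Hw; apply: esurj; apply: contraNneq Hw => ->; rewrite raddf0 mulr0 sin0 mulr0.
rewrite evh0 /ev; apply/eqP; rewrite eq_complex /= subr0 eqxx andbT; apply/eqP.
rewrite -usB; [|exact/sm_coef_bd/bd_cos|exact: coef_sm].
by apply: eq_us => w; rewrite mulrBr mulr1.
Qed.
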